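(* For all $0\leq u,v,w\leq n$, $$(-1)^{u+v+w}\, r^w_{u,v} \in \mathbb{Z}_+[e^{-\alpha}-1]_{\alpha\in\Delta^+},$$ where $r^w_{u,v}=w_o\bigl(b^{\,n-w}_{n-u,\,n-v}\bigr)$ and $b^w_{u,v}\in R(T)$ are the structure constants of $K_T(\mathbb{P}^n)$ defined by $[\mathcal{O}_{X_u}][\mathcal{O}_{X_v}]=\sum_{w=0}^n b^w_{u,v}[\mathcal{O}_{X_w}]$. Hence, for all $0\leq u,v,w\leq n$, $$(-1)^{n+u+v+w}\, b^w_{u,v} \in \mathbb{Z}_+[e^{\alpha}-1]_{\alpha\in\Delta^+}.$$
   Context: Everything is over $\mathbb{C}$. $G=SL_{n+1}$, $T=\{(t_1,\dots,t_{n+1})\in(\mathbb{C}^* )^{n+1} : \prod t_i=1\}$ is its diagonal maximal torus, acting in the obvious way on $\mathbb{P}^n$ with projective coordinates $[x_1,\dots,x_{n+1}]$. $R(T)$ is the representation ring of $T$, with $\mathbb{Z}$-basis the characters $e^\lambda$. The character $e^{\varepsilon_i}$ is $(t_1,\dots,t_{n+1})\mapsto t_i$, and $\Delta^+=\{\varepsilon_i-\varepsilon_j : 1\le i<j\le n+1\}$. $w_o$ is the longest element of the Weyl group of $SL_{n+1}$, acting on $R(T)$ by $w_o(e^{\varepsilon_i})=e^{\varepsilon_{n+2-i}}$. For $0\le u\le n$ let $X_u=\{[x_1,\dots,x_{u+1},0,\dots,0]\}\subset\mathbb{P}^n$. $K_T(\mathbb{P}^n)$ is the Grothendieck group of $T$-equivariant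 coherent sheaves (a ring, being also the Grothendieck group of $T$-equivariant vector bundles); $\{[\mathcal{O}_{X_u}]\}_{0\le u\le n}$ is an $R(T)$-basis of it. $\mathbb{Z}_+$ is the set of non-negative integers, and $\mathbb{Z}_+[e^{\pm\alpha}-1]_{\alpha\in\Delta^+}$ (for a fixed choice of sign) is the set of polynomials in the elements $e^{\pm\alpha}-1$ ($\alpha\in\Delta^+$) with coefficients in $\mathbb{Z}_+$. *)

(* Defs.v *)
From HB Require Import structures.
From mathcomp Require Import all_boot all_order all_algebra.
From mathcomp Require Import boolp functions reals.
From mathcomp Require Import complex.

Set Implicit Arguments.
Unset Strict Implicit.
Unset Printing Implicit Defensive.

Import Order.TTheory GRing.Theory Num.Theory.
Local Open Scope ring_scope.

(* The base field is C = R[i], with R the (unique up to isomorphism) complete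
   ordered field.  Coordinates are indexed from 0: the index i : 'I_n.+1 stands
   for the (i+1)-st coordinate of the usual 1-based numbering. *)

Section Torus.
Variables (R : realType) (n : nat).
Local Notation C := R[i].

Definition weight := {ffun 'I_n.+1 -> int}.

Definition in_torus (t : {ffun 'I_n.+1 -> C}) : bool := \prod_i t i == 1.
Definition torus := {t : {ffun 'I_n.+1 -> C} | in_torus t}.

Lemma torus_neq0 (t : torus) i : val t i != 0.
Proof.
apply/eqP => t0; have /eqP := valP t.
by rewrite (bigD1 i) //= t0 mul0r => /eqP; rewrite eq_sym oner_eq0.
Qed.

Lemma tone_subproof : in_torus [ffun=> 1].
Proof. by apply/eqP/big1 => i _; rewrite ffunE. Qed.
Definition tone : torus := exist in_torus _ tone_subproof.

Lemma tmul_subproof (s t : torus) : in_torus [ffun i => val s i * val t i].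
Proof.
rewrite /in_torus; under eq_bigr do rewrite ffunE.
by rewrite big_split (eqP (valP s)) (eqP (valP t)) /= mulr1.
Qed.
Definition tmul (s t : torus) : torus := exist in_torus _ (tmul_subproof s t).

Lemma tinv_subproof (t : torus) : in_torus [ffun i => (val t i)^-1].
Proof.
rewrite /in_torus; under eq_bigr do rewrite ffunE.
by rewrite prodfV (eqP (valP t)) invr1.
Qed.
Definition tinv (t : torus) : torus := exist in_torus _ (tinv_subproof t).

Lemma trev_subproof (t : torus) : in_torus [ffun i => val t (rev_ord i)].
Proof.
rewrite /in_torus; under eq_bigr do rewrite ffunE.
rewrite (reindex_inj rev_ord_inj) /=.
by under eq_bigr do rewrite rev_ordK; exact: valP t.
Qed.
Definition trev (t : torus) : torus := exist in_torus _ (trev_subproof t).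

Definition chi (l : weight) (t : torus) : C := \prod_i val t i ^ l i.

Lemma chi0 t : chi 0 t = 1.
Proof. by apply: big1 => i _; rewrite ffunE. Qed.

Lemma chiD l m t : chi (l + m) t = chi l t * chi m t.
Proof.
rewrite /chi -big_split; apply: eq_bigr => i _ /=.
by rewrite ffunE expfzDr ?torus_neq0.
Qed.

Lemma chi_tone l : chi l tone = 1.
Proof. by apply: big1 => i _; rewrite ffunE exp1rz. Qed.

Lemma chi_tmul l s t : chi l (tmul s t) = chi l s * chi l t.
Proof.
rewrite /chi -big_split; apply: eq_bigr => i _ /=.
by rewrite ffunE expfzMl.
Qed.

Lemma chi_trev l t : chi l (trev t) = chi [ffun i => l (rev_ord i)] t.
Proof.
rewrite /chi (reindex_inj rev_ord_inj) /=; apply: eq_bigr => i _.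
by rewrite !ffunE rev_ordK.
Qed.

(* A virtual representation of T is identified with its character, so R(T) is
   the ring of Z-linear combinations of characters, as functions on T. *)
Definition is_virtual_char (f : torus -> C) : Prop :=
  exists s : seq (int * weight),
    forall t, f t = \sum_(c <- s) c.1%:~R * chi c.2 t.

Definition virtual_char : {pred torus -> C} := fun f => `[< is_virtual_char f >].

Lemma virtual_char_closed : subring_closed virtual_char.
Proof.
split=> [|f g /asboolP[r fr] /asboolP[s gs]|f g /asboolP[r fr] /asboolP[s gs]].
- apply/asboolP; exists [:: (1, 0)] => t.
  by rewrite big_cons big_nil addr0 /= chi0 mulr1.
- apply/asboolP; exists (r ++ [seq (- c.1, c.2) | c <- s]) => t.
  rewrite big_cat big_map /= -fr.
  under eq_bigr do rewrite intrN mulNr.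
  by rewrite sumrN -gs.
- apply/asboolP.
  exists [seq (c.1 * d.1, c.2 + d.2) | c <- r, d <- s] => t.
  rewrite big_allpairs_dep [LHS](_ : _ = f t * g t) // fr gs mulr_suml.
  apply: eq_bigr => c _; rewrite mulr_sumr; apply: eq_bigr => d _ /=.
  by rewrite intrM chiD mulrACA.
Qed.

HB.instance Definition _ :=
  GRing.isSubringClosed.Build _ virtual_char virtual_char_closed.

Definition RT := {f : torus -> C | virtual_char f}.
HB.instance Definition _ := SubType.on RT.
HB.instance Definition _ := [Choice of RT by <:].
HB.instance Definition _ :=
  GRing.SubChoice_isSubComPzRing.Build _ virtual_char RT virtual_char_closed.

Lemma expc_subproof (l : weight) : virtual_char (chi l).
Proof.
apply/asboolP; exists [:: (1, l)] => t.
by rewrite big_cons big_nil addr0 mul1r.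
Qed.
(* the character e^l *)
Definition expc (l : weight) : RT := exist virtual_char (chi l) (expc_subproof l).

Lemma wo_subproof (f : RT) : virtual_char (fun t => val f (trev t)).
Proof.
have /asboolP[s fs] := valP f; apply/asboolP.
pose rv (l : weight) : weight := [ffun i => l (rev_ord i)].
exists [seq (c.1, rv c.2) | c <- s] => t.
by rewrite fs big_map; apply: eq_bigr => c _; rewrite chi_trev.
Qed.
Definition wo (f : RT) : RT := exist virtual_char _ (wo_subproof f).

(* the weight epsilon_i - epsilon_j *)
Definition root (i j : 'I_n.+1) : weight :=
  [ffun k => (k == i)%:Z - (k == j)%:Z].

Definition nonneg_poly (g : 'I_n.+1 -> 'I_n.+1 -> RT) (f : RT) : Prop :=
  exists s : seq (nat * {ffun 'I_n.+1 * 'I_n.+1 -> nat}),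
    f = \sum_(c <- s)
          c.1%:R * \prod_(p : 'I_n.+1 * 'I_n.+1 | (p.1 < p.2)%N) g p.1 p.2 ^+ c.2 p.

Definition Zplus_pos : RT -> Prop :=
  nonneg_poly (fun i j => expc (root i j) - 1).
Definition Zplus_neg : RT -> Prop :=
  nonneg_poly (fun i j => expc (- root i j) - 1).

End Torus.

Section RegularFunctions.
Variables (R : realType) (n : nat).
Local Notation C := R[i].
Local Notation torus := (torus R n).

(* Index set of the T-stable affine open cover of P^n that is closed under
   intersection: I stands for U_I = { x | x_i <> 0 for all i in I }, so that
   U_I `&` U_J = U_(I :|: J). *)
Definition opn := {I : {set 'I_n.+1} | I != set0}.

Definition incl (I J : opn) : bool := val I \subset val J.

Lemma incl_refl I : incl I I. Proof. exact: subxx. Qed.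
Lemma incl_trans I J K : incl I J -> incl J K -> incl I K.
Proof. exact: subset_trans. Qed.

(* homogeneous coordinate vectors of the points of U_I *)
Definition in_U (I : opn) (x : {ffun 'I_n.+1 -> C}) : bool :=
  [forall i in val I, x i != 0].
Definition pt (I : opn) := {x : {ffun 'I_n.+1 -> C} | in_U I x}.

Lemma ptr_subproof I J (h : incl I J) (x : pt J) : in_U I (val x).
Proof.
apply/forall_inP => i iI; have /forall_inP := valP x; apply.
exact: (subsetP h).
Qed.
Definition ptr I J (h : incl I J) (x : pt J) : pt I :=
  exist (in_U I) _ (ptr_subproof h x).

(* t . [x_1, ..., x_(n+1)] = [t_1 x_1, ..., t_(n+1) x_(n+1)] *)
Lemma ptt_subproof I (t : torus) (x : pt I) :
  in_U I [ffun i => val t i * val x i].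
Proof.
apply/forall_inP => i iI; rewrite ffunE mulf_neq0 ?torus_neq0 //.
by have /forall_inP := valP x; apply.
Qed.
Definition ptt I (t : torus) (x : pt I) : pt I :=
  exist (in_U I) _ (ptt_subproof t x).

Lemma ptt_tone I (x : pt I) : ptt (tone R n) x = x.
Proof. by apply/val_inj/ffunP => i; rewrite !ffunE mul1r. Qed.

Lemma ptt_tmul I s t (x : pt I) : ptt (tmul s t) x = ptt s (ptt t x).
Proof. by apply/val_inj/ffunP => i; rewrite !ffunE mulrA. Qed.

Lemma ptt_ptr I J (h : incl I J) t (x : pt J) :
  ptt t (ptr h x) = ptr h (ptt t x).
Proof. exact/val_inj. Qed.

Lemma tinv_tone : tinv (tone R n) = tone R n.
Proof. by apply/val_inj/ffunP => i; rewrite !ffunE invr1. Qed.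

Lemma tinv_tmul (s t : torus) : tinv (tmul s t) = tmul (tinv t) (tinv s).
Proof. by apply/val_inj/ffunP => i; rewrite !ffunE invfM mulrC. Qed.

Lemma tmulC (s t : torus) : tmul s t = tmul t s.
Proof. by apply/val_inj/ffunP => i; rewrite !ffunE mulrC. Qed.

(* O(U_I) is the C-algebra generated by the ratios x_j / x_i, i \in I *)
Inductive regular (I : opn) : (pt I -> C) -> Prop :=
| regular_cst c : regular (fun=> c)
| regular_ratio i j : i \in val I -> regular (fun x => val x j / val x i)
| regular_add f g : regular f -> regular g -> regular (fun x => f x + g x)
| regular_mul f g : regular f -> regular g -> regular (fun x => f x * g x).

Definition is_regular I : {pred pt I -> C} := fun f => `[< regular f >].
Arguments is_regular : clear implicits.

Lemma is_regular_closed I : subring_closed (is_regular I).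
Proof.
split=> [|f g /asboolP fr /asboolP gr|f g /asboolP fr /asboolP gr].
- exact/asboolP/regular_cst.
- have -> : f - g = fun x => f x + -1 * g x.
    by apply: funext => x; rewrite mulN1r.
  exact/asboolP/(regular_add fr)/(regular_mul _ gr)/regular_cst.
- exact/asboolP/regular_mul.
Qed.

HB.instance Definition _ I :=
  GRing.isSubringClosed.Build _ (is_regular I) (@is_regular_closed I).

Definition OU (I : opn) := {f : pt I -> C | is_regular I f}.
HB.instance Definition _ I := SubType.on (OU I).
HB.instance Definition _ I := [Choice of OU I by <:].
HB.instance Definition _ I :=
  GRing.SubChoice_isSubComPzRing.Build _ (is_regular I) (OU I)
    (@is_regular_closed I).

Lemma cstO_subproof I (c : C) : is_regular I (fun=> c).
Proof. exact/asboolP/regular_cst. Qed.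
Definition cstO I (c : C) : OU I := exist (is_regular I) _ (cstO_subproof I c).

Lemma resO_subproof I J (h : incl I J) (f : OU I) :
  is_regular J (fun x => val f (ptr h x)).
Proof.
apply/asboolP; have /asboolP := valP f; elim=> [c|i j iI|g k _ ? _ ?|g k _ ? _ ?].
- exact: regular_cst.
- by apply: regular_ratio; apply: (subsetP h).
- exact: regular_add.
- exact: regular_mul.
Qed.
Definition resO I J (h : incl I J) (f : OU I) : OU J :=
  exist (is_regular J) _ (resO_subproof h f).

(* (t . f)(x) = f(t^-1 . x) *)
Lemma actO_subproof I (t : torus) (f : OU I) :
  is_regular I (fun x => val f (ptt (tinv t) x)).
Proof.
apply/asboolP; have /asboolP := valP f; elim=> [c|i j iI|g k _ ? _ ?|g k _ ? _ ?].
- exact: regular_cst.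
- set c := (val t j)^-1 * val t i.
  have -> : (fun x : pt I => val (ptt (tinv t) x) j / val (ptt (tinv t) x) i)
          = (fun x => c * (val x j / val x i)).
    by apply: funext => x; rewrite !ffunE /c invfM invrK mulrACA.
  exact/regular_mul/regular_ratio/iI/regular_cst.
- exact: regular_add.
- exact: regular_mul.
Qed.
Definition actO I (t : torus) (f : OU I) : OU I :=
  exist (is_regular I) _ (actO_subproof t f).

End RegularFunctions.

Arguments is_regular R {n} I.

(* T-equivariant coherent sheaves on P^n, given by their sections over the
   cover (U_I): on an affine open set, coherent means associated to a finitely
   generated module, and restriction to U_J `<=` U_I must be the localization
   O(U_J) (x)_O(U_I) - ; note that O(U_J) is the localization of O(U_I) at the
   elements of O(U_I) which are invertible on U_J.  An equivariant structure is
   a compatible semilinear action of T on the sections, which is algebraic,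
   that is, every section is a finite sum of weight vectors. *)
Record sheaf (R : realType) (n : nat) := Sheaf {
  sec : forall I : opn n, lmodType (OU R I);
  res : forall I J : opn n, incl I J -> sec I -> sec J;
  act : forall I : opn n, torus R n -> sec I -> sec I;
  resD : forall I J (h : incl I J) m m', res h (m + m') = res h m + res h m';
  resZ : forall I J (h : incl I J) (f : OU R I) m,
    res h (f *: m) = resO h f *: res h m;
  res_id : forall I (h : incl I I) m, res h m = m;
  res_comp : forall I J K (h : incl I J) (h' : incl J K) (h'' : incl I K) m,
    res h' (res h m) = res h'' m;
  res_ker : forall I J (h : incl I J) m, res h m = 0 ->
    exists f : OU R I,
      (exists g : OU R J, g * resO h f = 1) /\ f *: m = 0;
  res_frac : forall I J (h : incl I J) (m : sec J),
    exists f : OU R I,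
      (exists g : OU R J, g * resO h f = 1) /\
      (exists m' : sec I, resO h f *: m = res h m');
  sec_fg : forall I, exists (r : nat) (e : 'I_r -> sec I),
    forall m, exists a : 'I_r -> OU R I, m = \sum_k a k *: e k;
  actD : forall I t (m m' : sec I), act t (m + m') = act t m + act t m';
  actZ : forall I t (f : OU R I) (m : sec I), act t (f *: m) = actO t f *: act t m;
  act1 : forall I (m : sec I), act (tone R n) m = m;
  actM : forall I s t (m : sec I), act (tmul s t) m = act s (act t m);
  act_res : forall I J (h : incl I J) t m, act t (res h m) = res h (act t m);
  act_alg : forall I (m : sec I), exists s : seq (weight n * sec I),
    {in s, forall p t, act t p.2 = cstO I (chi p.1 t) *: p.2} /\
    m = \sum_(p <- s) p.2 }.

Section Sheaves.
Variables (R : realType) (n : nat).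
Local Notation C := R[i].
Local Notation torus := (torus R n).
Local Notation pt := (pt R).
Local Notation OU := (OU R).
Local Notation is_regular := (is_regular R).
Local Notation sheaf := (sheaf R n).

Definition is_hom (F G : sheaf) (phi : forall I, sec F I -> sec G I) : Prop :=
  [/\ forall I, linear (phi I),
      forall I J (h : incl I J) m, phi J (res h m) = res h (phi I m)
    & forall I t m, phi I (act t m) = act t (phi I m)].

Definition short_exact (F' F F'' : sheaf) : Prop :=
  exists (phi : forall I, sec F' I -> sec F I)
         (psi : forall I, sec F I -> sec F'' I),
    is_hom phi /\ is_hom psi /\
    forall I, [/\ injective (phi I),
                  forall m, psi I m = 0 <-> exists m', m = phi I m'
                & forall m'', exists m, psi I m = m''].

(* Near every point x, F becomes free after inverting some f with f(x) <> 0. *)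
Definition locally_free (F : sheaf) : Prop :=
  forall (I : opn n) (x : pt I), exists f : OU I, val f x != 0 /\
    exists (r : nat) (e : 'I_r -> sec F I),
      (forall m, exists (k : nat) (a : 'I_r -> OU I),
         f ^+ k *: m = \sum_j a j *: e j) /\
      (forall a : 'I_r -> OU I, \sum_j a j *: e j = 0 ->
         forall j, exists k : nat, f ^+ k * a j = 0).

Definition bilinear (A : comPzRingType) (L M N : lmodType A)
    (beta : L -> M -> N) : Prop :=
  (forall m, linear (beta^~ m)) /\ (forall l, linear (beta l)).

Definition is_tensor (E F G : sheaf) : Prop :=
  exists beta : forall I, sec E I -> sec F I -> sec G I,
    (forall I, bilinear (beta I)) /\
    (forall I J (h : incl I J) e f,
       beta J (res h e) (res h f) = res h (beta I e f)) /\
    (forall I t e f, beta I (act t e) (act t f) = act t (beta I e f)) /\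
    (forall I (N : lmodType (OU I)) (gamma : sec E I -> sec F I -> N),
       bilinear gamma ->
       exists2 g : sec G I -> N,
         linear g /\ (forall e f, g (beta I e f) = gamma e f)
       & forall g' : sec G I -> N,
           linear g' /\ (forall e f, g' (beta I e f) = gamma e f) -> g' =1 g).

(* The tensor product of F with the one-dimensional representation of weight l *)
Section Twist.
Variables (l : weight n) (F : sheaf).

Definition twist_act I (t : torus) (m : sec F I) : sec F I :=
  cstO I (chi l t) *: act t m.

Lemma twist_actD I t (m m' : sec F I) :
  twist_act t (m + m') = twist_act t m + twist_act t m'.
Proof. by rewrite /twist_act actD scalerDr. Qed.

Lemma twist_actZ I t (f : OU I) (m : sec F I) :
  twist_act t (f *: m) = actO t f *: twist_act t m.
Proof. by rewrite /twist_act actZ !scalerA mulrC. Qed.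

Lemma cstO1 (I : opn n) : cstO I (1 : C) = 1. Proof. exact/val_inj. Qed.
Lemma cstOM (I : opn n) (c d : C) : cstO I (c * d) = cstO I c * cstO I d.
Proof. exact/val_inj. Qed.
Lemma actO_cst (I : opn n) (t : torus) (c : C) : actO t (cstO I c) = cstO I c.
Proof. exact/val_inj. Qed.
Lemma resO_cst (I J : opn n) (h : incl I J) (c : C) : resO h (cstO I c) = cstO J c.
Proof. exact/val_inj. Qed.

Lemma twist_act1 I (m : sec F I) : twist_act (tone R n) m = m.
Proof. by rewrite /twist_act chi_tone cstO1 scale1r act1. Qed.

Lemma twist_actM I s t (m : sec F I) :
  twist_act (tmul s t) m = twist_act s (twist_act t m).
Proof.
by rewrite /twist_act actZ actO_cst actM scalerA chi_tmul cstOM.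
Qed.

Lemma twist_act_res I J (h : incl I J) t (m : sec F I) :
  twist_act t (res h m) = res h (twist_act t m).
Proof. by rewrite /twist_act resZ resO_cst act_res. Qed.

Lemma twist_act_alg I (m : sec F I) : exists s : seq (weight n * sec F I),
  {in s, forall p t, twist_act t p.2 = cstO I (chi p.1 t) *: p.2} /\
  m = \sum_(p <- s) p.2.
Proof.
have [s [sw ->]] := act_alg m; exists [seq (l + p.1, p.2) | p <- s].
split; last by rewrite big_map.
move=> _ /mapP[p ps ->] t /=.
by rewrite /twist_act sw // scalerA chiD cstOM.
Qed.

Definition twist : sheaf :=
  Sheaf (@resD _ _ F) (@resZ _ _ F) (@res_id _ _ F) (@res_comp _ _ F)
    (@res_ker _ _ F) (@res_frac _ _ F) (@sec_fg _ _ F)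
    twist_actD twist_actZ twist_act1 twist_actM twist_act_res twist_act_alg.

End Twist.

(* The structure sheaf of X_u: its sections on U_I are the functions on
   X_u `&` U_I which are restrictions of regular functions on U_I. *)
Section StructureSheaf.
Variable u : 'I_n.+1.

Definition in_X (I : opn n) (x : pt I) : bool :=
  [forall j : 'I_n.+1, (u < j)%N ==> (val x j == 0)].
Definition xpt (I : opn n) := {x : pt I | in_X x}.

Lemma xptr_subproof I J (h : incl I J) (x : xpt J) : in_X (ptr h (val x)).
Proof. exact: (valP x). Qed.
Definition xptr I J (h : incl I J) (x : xpt J) : xpt I :=
  exist (@in_X I) _ (xptr_subproof h x).

Lemma xptt_subproof I (t : torus) (x : xpt I) : in_X (ptt t (val x)).
Proof.
apply/forallP => j; apply/implyP => uj; rewrite ffunE.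
by have /forallP/(_ j)/implyP/(_ uj)/eqP -> := valP x; rewrite mulr0.
Qed.
Definition xptt I (t : torus) (x : xpt I) : xpt I :=
  exist (@in_X I) _ (xptt_subproof t x).

Definition is_xregular (I : opn n) : {pred xpt I -> C} :=
  fun g => `[< exists f : OU I, forall x, g x = val f (val x) >].
Arguments is_xregular : clear implicits.

Lemma is_xregular_closed I : zmod_closed (is_xregular I).
Proof.
split=> [|g k /asboolP[f gf] /asboolP[f' kf]]; apply/asboolP.
  by exists 0.
by exists (f - f') => x; rewrite [LHS](_ : _ = g x - k x) // gf kf.
Qed.

HB.instance Definition _ I :=
  GRing.isZmodClosed.Build _ (is_xregular I) (is_xregular_closed I).

Definition OXsec (I : opn n) := {g : xpt I -> C | is_xregular I g}.
HB.instance Definition _ I := SubType.on (OXsec I).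
HB.instance Definition _ I := [Choice of OXsec I by <:].
HB.instance Definition _ I := [SubChoice_isSubZmodule of OXsec I by <:].

Lemma OXsec_eqP I (g k : OXsec I) : val g =1 val k -> g = k.
Proof. by move=> /funext gk; exact: val_inj. Qed.

Lemma OXscale_subproof I (f : OU I) (g : OXsec I) :
  is_xregular I (fun x => val f (val x) * val g x).
Proof.
have /asboolP[k gk] := valP g; apply/asboolP.
by exists (f * k) => x; rewrite gk.
Qed.
Definition OXscale I (f : OU I) (g : OXsec I) : OXsec I :=
  exist (is_xregular I) _ (OXscale_subproof f g).

Lemma OXscaleA I (a b : OU I) v : OXscale a (OXscale b v) = OXscale (a * b) v.
Proof. by apply: OXsec_eqP => x /=; rewrite mulrA. Qed.
Lemma OXscale1 I : left_id (1 : OU I) (@OXscale I).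
Proof. by move=> g; apply: OXsec_eqP => x /=; rewrite mul1r. Qed.
Lemma OXscaleDr I : right_distributive (@OXscale I) +%R.
Proof. by move=> f g k; apply: OXsec_eqP => x; exact: mulrDr. Qed.
Lemma OXscaleDl I v : {morph (@OXscale I)^~ v : a b / a + b}.
Proof. by move=> f g; apply: OXsec_eqP => x; exact: mulrDl. Qed.

HB.instance Definition _ I := GRing.Zmodule_isLmodule.Build (OU I) (OXsec I)
  (@OXscaleA I) (@OXscale1 I) (@OXscaleDr I) (@OXscaleDl I).

Lemma OXres_subproof I J (h : incl I J) (g : OXsec I) :
  is_xregular J (fun x => val g (xptr h x)).
Proof.
have /asboolP[k gk] := valP g; apply/asboolP.
by exists (resO h k) => x; rewrite gk.
Qed.
Definition OXres I J (h : incl I J) (g : OXsec I) : OXsec J :=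
  exist (is_xregular J) _ (OXres_subproof h g).

Lemma OXact_subproof I (t : torus) (g : OXsec I) :
  is_xregular I (fun x => val g (xptt (tinv t) x)).
Proof.
have /asboolP[k gk] := valP g; apply/asboolP.
by exists (actO t k) => x; rewrite gk.
Qed.
Definition OXact I (t : torus) (g : OXsec I) : OXsec I :=
  exist (is_xregular I) _ (OXact_subproof t g).


Lemma OXresD I J (h : incl I J) (m m' : OXsec I) :
  OXres h (m + m') = OXres h m + OXres h m'.
Proof. exact: OXsec_eqP. Qed.

Lemma OXresZ I J (h : incl I J) (f : OU I) (m : OXsec I) :
  OXres h (f *: m) = resO h f *: OXres h m.
Proof. exact: OXsec_eqP. Qed.

Lemma OXres_id I (h : incl I I) (m : OXsec I) : OXres h m = m.
Proof.
by apply: OXsec_eqP => x /=; congr (val m _); exact/val_inj/val_inj.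
Qed.

Lemma OXres_comp I J K (h : incl I J) (h' : incl J K) (h'' : incl I K)
  (m : OXsec I) : OXres h' (OXres h m) = OXres h'' m.
Proof.
apply: OXsec_eqP => x; rewrite [LHS]/= [RHS]/=; apply: congr1.
exact/val_inj/val_inj.
Qed.

Lemma OXactD I t (m m' : OXsec I) : OXact t (m + m') = OXact t m + OXact t m'.
Proof. exact: OXsec_eqP. Qed.

Lemma OXactZ I t (f : OU I) (m : OXsec I) :
  OXact t (f *: m) = actO t f *: OXact t m.
Proof. exact: OXsec_eqP. Qed.

Lemma OXact1 I (m : OXsec I) : OXact (tone R n) m = m.
Proof.
apply: OXsec_eqP => x /=; congr (val m _); apply: val_inj => /=.
by rewrite tinv_tone ptt_tone.
Qed.

Lemma OXactM I s t (m : OXsec I) : OXact (tmul s t) m = OXact s (OXact t m).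
Proof.
apply: OXsec_eqP => x /=; congr (val m _); apply: val_inj => /=.
by rewrite tinv_tmul ptt_tmul.
Qed.

Lemma OXact_res I J (h : incl I J) t (m : OXsec I) :
  OXact t (OXres h m) = OXres h (OXact t m).
Proof.
apply: OXsec_eqP => x; rewrite [LHS]/= [RHS]/=; apply: congr1.
exact/val_inj/val_inj.
Qed.

Lemma OXsec_fg I : exists (r : nat) (e : 'I_r -> OXsec I),
  forall m, exists a : 'I_r -> OU I, m = \sum_k a k *: e k.
Proof.
have one_reg : is_xregular I (fun=> 1) by apply/asboolP; exists 1.
exists 1%N, (fun=> exist (is_xregular I) _ one_reg) => m.
have /asboolP[f mf] := valP m; exists (fun=> f).
by rewrite big_ord1; apply: OXsec_eqP => x /=; rewrite mulr1 mf.
Qed.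

Lemma ratio_prod_subproof (I : opn n) (i : 'I_n.+1) (s : seq 'I_n.+1) :
  i \in val I -> is_regular I (fun x : pt I => \prod_(j <- s) (val x j / val x i)).
Proof.
move=> iI; apply/asboolP; elim: s => [|j s IHs].
  by under eq_fun do rewrite big_nil; exact: regular_cst.
under eq_fun do rewrite big_cons.
by apply: regular_mul => //; exact: regular_ratio.
Qed.

(* U_J is the principal open subset of U_I defined by d *)
Lemma principal (I J : opn n) (h : incl I J) : exists d : OU I,
  [/\ exists d' : OU J, d' * resO h d = 1,
      forall x : pt I, ~~ in_U J (val x) -> val d x = 0
    & forall f : OU J, exists (k : nat) (f' : OU I),
        resO h (d ^+ k) * f = resO h f'].
Proof.
have /set0Pn[i iI] := valP I.
have iJ := subsetP h _ iI.
have xJ (x : pt J) j : j \in val J -> val x j != 0.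
  by have /forall_inP := valP x; apply.
pose D s : OU I := exist (is_regular I) _ (ratio_prod_subproof s iI).
exists (D (enum (val J))); split.
- have reg' (s : seq 'I_n.+1) : {subset s <= val J} ->
      is_regular J (fun x : pt J => \prod_(j <- s) (val x i / val x j)).
    move=> sJ; apply/asboolP; elim: s sJ => [|j s IHs] sJ.
      by under eq_fun do rewrite big_nil; exact: regular_cst.
    under eq_fun do rewrite big_cons.
    apply: regular_mul; first by apply: regular_ratio; apply: sJ; exact: mem_head.
    by apply: IHs => k ks; apply: sJ; rewrite inE ks orbT.
  have sJ : {subset enum (val J) <= val J} by move=> j; rewrite mem_enum.
  exists (exist (is_regular J) _ (reg' _ sJ)).
  apply/val_inj/funext => x.
  rewrite [LHS](_ : _ = \prod_(j <- enum (val J)) (val x i / val x j)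
                      * \prod_(j <- enum (val J)) (val x j / val x i)) //.
  rewrite -big_split /= [LHS]big1_seq // => j /andP[_]; rewrite mem_enum => jJ.
  by rewrite mulrA divfK ?xJ // divff ?xJ.
- move=> x /forallPn[j]; rewrite negb_imply negbK => /andP[jJ /eqP xj0].
  rewrite /= (big_rem j) ?mem_enum //=.
  by rewrite [X in X / _]xj0 !mul0r.
- move=> f; have /asboolP fr := valP f; move: fr; rewrite -/(regular (val f)).
  set d := D _.
  suff H : forall g, regular g -> exists (k : nat) (f' : OU I),
      forall x : pt J, val d (ptr h x) ^+ k * g x = val f' (ptr h x).
    move=> /H[k [f' E]]; exists k, f'; apply/val_inj/funext => x.
    transitivity (val d (ptr h x) ^+ k * val f x); last exact: E.
    congr (_ * _); elim: k {E} => // k IHk.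
    by rewrite [RHS]exprS -IHk exprS.
  move=> g; elim=> [c|j a jJ|g1 g2 _ [k1 [f1 E1]] _ [k2 [f2 E2]]
                              |g1 g2 _ [k1 [f1 E1]] _ [k2 [f2 E2]]].
  + by exists 0%N, (cstO I c) => x; rewrite mul1r.
  + pose ra : OU I :=
      exist (is_regular I) (fun x => val x a / val x i)
        (asboolT (@regular_ratio R n I i a iI)).
    exists 1%N, (D (rem j (enum (val J))) * ra) => x.
    rewrite expr1 [RHS](_ : _ = \prod_(k <- rem j (enum (val J)))
      (val x k / val x i) * (val x a / val x i)) //.
    rewrite /d /= (big_rem j) ?mem_enum //=.
    rewrite mulrAC [RHS]mulrC; congr (_ * _).
    by rewrite mulrC mulrA divfK ?xJ.
  + exists (k1 + k2)%N, (d ^+ k2 * f1 + d ^+ k1 * f2) => x.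
    have dX k : val (d ^+ k) (ptr h x) = val d (ptr h x) ^+ k.
      by elim: k => // k IHk; rewrite [RHS]exprS -IHk exprS.
    rewrite [RHS](_ : _ = val (d ^+ k2) (ptr h x) * val f1 (ptr h x)
       + val (d ^+ k1) (ptr h x) * val f2 (ptr h x)) //.
    by rewrite !dX -E1 -E2 mulrDr exprD !mulrA [X in X * g1 x]mulrC.
  + exists (k1 + k2)%N, (f1 * f2) => x.
    rewrite [RHS](_ : _ = val f1 (ptr h x) * val f2 (ptr h x)) //.
    by rewrite -E1 -E2 exprD mulrACA.
Qed.

Lemma OXres_ker I J (h : incl I J) (m : OXsec I) : OXres h m = 0 ->
  exists f : OU I, (exists g : OU J, g * resO h f = 1) /\ f *: m = 0.
Proof.
move=> m0; have [d [dU d0 _]] := principal h; exists d; split=> //.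
apply: OXsec_eqP => x.
rewrite [LHS](_ : _ = val d (val x) * val m x) //.
have [xJ|/d0 ->] := boolP (in_U J (val (val x))); last by rewrite mul0r.
pose y : pt J := exist (in_U J) _ xJ.
have yX : in_X y by exact: (valP x).
have -> : x = xptr h (exist (@in_X J) y yX) by exact/val_inj/val_inj.
have /(congr1 val) := m0.
by move=> /(congr1 (@^~ (exist (@in_X J) y yX))) /= ->; rewrite mulr0.
Qed.

Lemma OXres_frac I J (h : incl I J) (m : OXsec J) :
  exists f : OU I, (exists g : OU J, g * resO h f = 1) /\
    (exists m' : OXsec I, resO h f *: m = OXres h m').
Proof.
have [d [[d' d'd] _ dfrac]] := principal h.
have resX k : resO h (d ^+ k) = resO h d ^+ k.
  by elim: k => [|k IHk]; [exact: val_inj|rewrite !exprS -IHk; exact: val_inj].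
have /asboolP[f mf] := valP m; have [k [f' E]] := dfrac f.
exists (d ^+ k); split.
  by exists (d' ^+ k); rewrite resX -exprMn d'd expr1n.
have fX : is_xregular I (fun x => val f' (val x)) by apply/asboolP; exists f'.
exists (exist (is_xregular I) _ fX); apply: OXsec_eqP => x.
rewrite [LHS](_ : _ = val (resO h (d ^+ k)) (val x) * val m x) // mf.
by have /(congr1 val)/(congr1 (@^~ (val x))) := E.
Qed.

Lemma OXact_alg I (m : OXsec I) : exists s : seq (weight n * OXsec I),
  {in s, forall p t, OXact t p.2 = cstO I (chi p.1 t) *: p.2} /\
  m = \sum_(p <- s) p.2.
Proof.
pose P (s : seq (weight n * (pt I -> C))) (f : pt I -> C) :=
  [/\ forall p, p \in s -> regular p.2,
      forall p, p \in s -> forall t x, p.2 (ptt (tinv t) x) = chi p.1 t * p.2 x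
    & forall x, f x = \sum_(p <- s) p.2 x].
have H f : regular f -> exists s, P s f.
  elim=> [c|i a iI|g1 g2 _ [s1 [r1 w1 E1]] _ [s2 [r2 w2 E2]]
                  |g1 g2 _ [s1 [r1 w1 E1]] _ [s2 [r2 w2 E2]]].
  - exists [:: (0, fun=> c)]; split=> [p|p|x]; rewrite ?big_seq1 // inE => /eqP->.
      exact: regular_cst.
    by move=> t x; rewrite chi0 mul1r.
  - exists [:: (root i a, fun x : pt I => val x a / val x i)].
    split=> [p|p|x]; rewrite ?big_seq1 // inE => /eqP->.
      exact: regular_ratio.
    move=> t x /=; rewrite !ffunE invfM invrK mulrACA; congr (_ * _).
    rewrite /chi (eq_bigr (fun k => (if k == i then val t k else 1) *
                   (if k == a then (val t k)^-1 else 1))); last first.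
      move=> k _; rewrite ffunE; have tk := torus_neq0 t k.
      by do 2 case: eqP => _; rewrite ?subrr ?sub0r ?subr0 ?mulr1 ?mul1r ?divff.
    by rewrite big_split /= -!big_mkcond !big_pred1_eq mulrC.
  - exists (s1 ++ s2); split=> [p|p|x].
    + by rewrite mem_cat => /orP[/r1|/r2].
    + by rewrite mem_cat => /orP[/w1|/w2].
    + by rewrite big_cat /= -E1 -E2.
  - exists [seq (p.1 + q.1, fun x => p.2 x * q.2 x) | p <- s1, q <- s2].
    split=> [_ /allpairsP[[p q] /= [ps qs ->]]|_ /allpairsP[[p q] /= [ps qs ->]]|x].
    + by apply: regular_mul; [exact: r1|exact: r2].
    + by move=> t x /=; rewrite w1 // w2 // chiD mulrACA.
    + rewrite big_allpairs_dep /= E1 E2 mulr_suml; apply: eq_bigr => p _.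
      by rewrite mulr_sumr.
have /asboolP[f mf] := valP m; have /asboolP/H[s [sr sw sE]] := valP f.
have xr (p : weight n * (pt I -> C)) : regular p.2 ->
    is_xregular I (fun x => p.2 (val x)).
  by move=> pr; apply/asboolP; exists (exist (is_regular I) p.2 (asboolT pr)).
pose F (p : weight n * (pt I -> C)) : OXsec I :=
  if pselect (regular p.2) is left pr then exist (is_xregular I) _ (xr p pr) else 0.
have FE p : p \in s -> forall x, val (F p) x = p.2 (val x).
  by move=> /sr pr x; rewrite /F; case: pselect.
exists [seq (p.1, F p) | p <- s]; split.
  move=> _ /mapP[p ps ->] t; apply: OXsec_eqP => x /=.
  by rewrite !FE // sw.
rewrite big_map; apply: OXsec_eqP => x; rewrite mf sE.
rewrite [RHS](_ : _ = \sum_(p <- s) val (F p) x).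
  by rewrite !big_seq; apply: eq_bigr => p ps; rewrite FE.
elim: {sr sw sE FE} s => [|p s IHs]; first by rewrite !big_nil.
by rewrite !big_cons -IHs.
Qed.

Definition OX : sheaf :=
  Sheaf OXresD OXresZ OXres_id OXres_comp OXres_ker OXres_frac OXsec_fg
    OXactD OXactZ OXact1 OXactM OXact_res OXact_alg.

End StructureSheaf.

(* K, with F |-> [F], is K_T(P^n): the Grothendieck group of T-equivariant
   coherent sheaves, with the R(T)-module structure e^l [F] = [F (x) C_l] and
   the product induced by the tensor product of equivariant vector bundles.
   These properties determine K up to a unique isomorphism. *)
Record is_KT (K : comAlgType (RT R n)) (cls : sheaf -> K) : Prop := {
  KT_exact : forall F' F F'',
    short_exact F' F F'' -> cls F = cls F' + cls F'';
  KT_universal : forall (A : zmodType) (phi : sheaf -> A),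
    (forall F' F F'', short_exact F' F F'' -> phi F = phi F' + phi F'') ->
    exists f : {additive K -> A}, forall F, f (cls F) = phi F;
  KT_generated : forall (A : zmodType) (f g : {additive K -> A}),
    (forall F, f (cls F) = g (cls F)) -> f =1 g;
  KT_scale : forall l F, expc R l *: cls F = cls (twist l F);
  KT_tensor : forall E F G, locally_free E -> locally_free F ->
    is_tensor E F G -> cls E * cls F = cls G }.

End Sheaves.

(* Main.v *)
(* In K_T(P^n), write O_u = [O_{X_u}] and z for multiplication by [O(-1)], that
   is, the operator F |-> F(-1).  Multiplication by the coordinate x_w gives
   0 -> O_{X_w}(-1) (x) C_{-eps_w} -> O_{X_w} -> O_{X_{w-1}} -> 0, hence
   O_{w-1} = (1 - e^{-eps_w} z) O_w and z O_w = e^{eps_w} (O_w - O_{w-1}).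
   Therefore O_u O_v is obtained from O_v by the operators 1 - e^{-eps_j} z for
   j = n, ..., u+1, and
     (1 - e^{-eps_j} z) O_w
       = - (e^{eps_w - eps_j} - 1) O_w + e^{eps_w - eps_j} O_{w-1}.
   When the operators are applied in decreasing order of j, the j-th one meets
   only terms with w <= j, because it has coefficient 0 on O_j itself; so all
   signs are as claimed.

   The coefficients are determined because the O_w are linearly independent
   over R(T).  Indeed, the dimension of a weight space of the sections on the
   affine chart U_i around the i-th fixed point is finite and additive on exact
   sequences; O_w vanishes on U_i for w < i, and in O_i the weight 0 is minimal
   and occurs once. *)

Require Import Defs.
From HB Require Import structures.
From mathcomp Require Import all_boot all_order all_algebra.
From mathcomp Require Import boolp functions reals.
From mathcomp Require Import complex ring zify.

Set Implicit Arguments.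
Unset Strict Implicit.
Unset Printing Implicit Defensive.

Import Order.TTheory GRing.Theory Num.Theory.
Local Open Scope ring_scope.

(** * The ring R(T) and the combinatorial structure constants *)

Section Positivity.
Variables (R : realType) (n : nat).
Local Notation RT := (RT R n).
Local Notation expc := (@expc R n).

Lemma expc0 : expc 0 = 1.
Proof. by apply/val_inj/funext => t; rewrite /= chi0. Qed.

Lemma expcD l m : expc (l + m) = expc l * expc m.
Proof. by apply/val_inj/funext => t; rewrite /= chiD. Qed.

Lemma expcK l : expc l * expc (- l) = 1.
Proof. by rewrite -expcD subrr expc0. Qed.

Variable g : 'I_n.+1 -> 'I_n.+1 -> RT.

Lemma nonneg_poly0 : nonneg_poly g 0.
Proof. by exists [::]; rewrite big_nil. Qed.

Lemma nonneg_polyD a b :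
  nonneg_poly g a -> nonneg_poly g b -> nonneg_poly g (a + b).
Proof. by move=> [s ->] [r ->]; exists (s ++ r); rewrite big_cat. Qed.

Lemma nonneg_polyM a b :
  nonneg_poly g a -> nonneg_poly g b -> nonneg_poly g (a * b).
Proof.
move=> [s ->] [r ->].
exists [seq ((c.1 * d.1)%N, [ffun p => (c.2 p + d.2 p)%N]) |
    c : nat * {ffun 'I_n.+1 * 'I_n.+1 -> nat} <- s,
    d : nat * {ffun 'I_n.+1 * 'I_n.+1 -> nat} <- r].
rewrite big_allpairs_dep mulr_suml; apply: eq_bigr => c _.
rewrite mulr_sumr; apply: eq_bigr => d _ /=.
rewrite natrM mulrACA -big_split /=; congr (_ * _).
by apply: eq_bigr => p _; rewrite ffunE exprD.
Qed.

Lemma nonneg_poly_nat c : nonneg_poly g c%:R.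
Proof.
exists [:: (c, [ffun=> 0%N])]; rewrite big_seq1 /= big1 ?mulr1 // => p _.
by rewrite ffunE.
Qed.

Lemma nonneg_poly_gen (i j : 'I_n.+1) : (i < j)%N -> nonneg_poly g (g i j).
Proof.
move=> ij; exists [:: (1%N, [ffun p => (p == (i, j)) : nat])].
rewrite big_seq1 mul1r (bigD1 (i, j)) //= ffunE eqxx expr1 big1 ?mulr1 // => p.
by move=> /andP[_ /negPf pij]; rewrite ffunE pij.
Qed.

Lemma nonneg_polyX a k : nonneg_poly g a -> nonneg_poly g (a ^+ k).
Proof.
move=> ga; elim: k => [|k IHk]; first exact: (nonneg_poly_nat 1).
by rewrite exprS; exact: nonneg_polyM.
Qed.

End Positivity.

(** * The longest element [wo] on R(T) and its effect on positivity *)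

Section LongestElement.
Variables (R : realType) (n : nat).
Local Notation RT := (RT R n).

Lemma wo_is_zmod_morphism : zmod_morphism (@wo R n).
Proof. by move=> a b; exact/val_inj/funext. Qed.
HB.instance Definition _ :=
  GRing.isZmodMorphism.Build RT RT (@wo R n) wo_is_zmod_morphism.

Lemma wo_is_monoid_morphism : monoid_morphism (@wo R n).
Proof. by split=> [|a b]; exact/val_inj/funext. Qed.
HB.instance Definition _ :=
  GRing.isMonoidMorphism.Build RT RT (@wo R n) wo_is_monoid_morphism.

(** Reversing the indices reverses their order, so a positive root goes to the negative of a
    positive root. This is what turns the generators e^alpha - 1 into e^{-alpha} - 1. *)
Lemma wo_root (i j : 'I_n.+1) :
  wo (expc R (Defs.root i j)) = expc R (- Defs.root (rev_ord j) (rev_ord i)).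
Proof.
apply/val_inj/funext => t /=; rewrite chi_trev; congr (chi _ t).
apply/ffunP => k; rewrite !ffunE opprB.
by rewrite -!(can2_eq rev_ordK rev_ordK).
Qed.

Lemma wo_Zplus (a : RT) : Zplus_pos a -> Zplus_neg (wo a).
Proof.
move=> [s ->]; rewrite rmorph_sum /=.
elim: s => [|c s IHs]; first by rewrite big_nil; exact: nonneg_poly0.
rewrite big_cons; apply: nonneg_polyD => //.
rewrite rmorphM rmorph_nat; apply: nonneg_polyM; first exact: nonneg_poly_nat.
rewrite rmorph_prod; apply: big_ind => [||p ltp].
  exact: (nonneg_poly_nat _ 1).
  by move=> *; exact: nonneg_polyM.
rewrite rmorphXn rmorphB rmorph1 /= wo_root; apply/nonneg_polyX/nonneg_poly_gen.
by have /= := ltn_ord p.2; lia.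
Qed.

End LongestElement.

(** * The recursion for the structure constants *)

Section Structure.
Variables (R : realType) (n : nat).
Local Notation RT := (RT R n).
Local Notation expc := (@expc R n).

(* [eps m] is 0 for m > n *)
Definition eps (m : nat) : weight n := [ffun k : 'I_n.+1 => (k == m :> nat)%:Z].

Lemma root_eps (i j : 'I_n.+1) : Defs.root i j = eps i - eps j.
Proof. by apply/ffunP => k; rewrite !ffunE. Qed.

(* [strc d v w] is the coefficient of [O_{X_w}] in the product of the factors
   [1 - e^{-eps_j} z], j = n, ..., n - d + 1, applied in this order to
   [O_{X_v}]; here z is the class of O(-1). *)
Fixpoint strc (d v w : nat) : RT :=
  if d is d'.+1 then
    strc d' v w * (1 - expc (eps w - eps (n - d')))
    + strc d' v w.+1 * expc (eps w.+1 - eps (n - d'))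
  else (v == w)%:R.

(** Each operator lowers the highest possible index by one: its diagonal coefficient at w = j is 1 -
    e^0 = 0, and no index above j is present any more. *)
Lemma strc_eq0 d v w : (v <= n)%N -> (d <= n)%N -> (n - d < w)%N -> strc d v w = 0.
Proof.
elim: d v w => [|d IHd] v w vn dn nw /=.
  by rewrite (_ : (v == w) = false) //; apply/eqP; lia.
rewrite [strc d v w.+1]IHd ?mul0r ?addr0; try lia.
have [->|wd] := eqVneq w (n - d)%N; first by rewrite subrr expc0 subrr mulr0.
by rewrite IHd ?mul0r //; lia.
Qed.

(** In the diagonal term only d changes parity, and this absorbs the sign of 1 - e^alpha. In the
    lowering term d and w change together, so the sign stays, and e^alpha = (e^alpha - 1) + 1 is
    positive. *)
Lemma strc_pos d v w : (v <= n)%N -> (d <= n)%N ->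
  Zplus_pos ((-1) ^+ (d + v + w) * strc d v w).
Proof.
have gen i j : (i < j <= n)%N -> Zplus_pos (expc (eps i - eps j) - 1).
  move=> /andP[ij jn]; have [hi hj] : (i < n.+1 /\ j < n.+1)%N by lia.
  have := @nonneg_poly_gen R n (fun i j => expc (Defs.root i j) - 1)
    (Ordinal hi) (Ordinal hj) ij.
  by rewrite root_eps.
have gen1 i j : (i <= j <= n)%N -> Zplus_pos (expc (eps i - eps j)).
  move=> /andP[]; rewrite leq_eqVlt => /orP[/eqP->|ij] jn.
    by rewrite subrr expc0; exact: (nonneg_poly_nat _ 1).
  rewrite -[expc _](subrK 1).
  apply: nonneg_polyD; last exact: (nonneg_poly_nat _ 1).
  by apply: gen; rewrite ij.
elim: d v w => [|d IHd] v w vn dn /=.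
  have [->|_] := eqVneq v w; last by rewrite mulr0; exact: nonneg_poly0.
  by rewrite mulr1 addnn -signr_odd odd_double; exact: (nonneg_poly_nat _ 1).
rewrite mulrDr; apply: nonneg_polyD.
  have [wd|wd] := ltnP w (n - d)%N; last first.
    move: wd; rewrite leq_eqVlt => /orP[/eqP<-|wd].
      by rewrite subrr expc0 subrr !mulr0; exact: nonneg_poly0.
    by rewrite strc_eq0 ?mul0r ?mulr0; [exact: nonneg_poly0|lia..].
  rewrite -(opprB (expc _)) mulrN mulrN mulrA -!mulNr !addSn exprS mulN1r opprK.
  apply: nonneg_polyM; first by apply: IHd; lia.
  by apply: gen; lia.
have [wd|wd] := leqP w.+1 (n - d)%N; last first.
  by rewrite strc_eq0 ?mul0r ?mulr0; [exact: nonneg_poly0|lia..].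
rewrite mulrA !addSn -addnS; apply: nonneg_polyM; first by apply: IHd; lia.
by apply: gen1; lia.
Qed.

(* [A m k] is modelled on the class of O(-k) on the coordinate subspace with
   [m] coordinates. *)
Variables (K : comAlgType RT) (A : nat -> nat -> K).
Hypothesis A0 : forall k, A 0 k = 0.
Hypothesis AS : forall m k, (m <= n)%N ->
  A m k = A m.+1 k - expc (- eps m) *: A m.+1 k.+1.
Hypothesis AM : forall j k, A n.+1 j * A n.+1 k = A n.+1 (j + k).

(** Multiplication by O(-j) is the j-fold twist: [AM] gives this on the whole space, and [AS]
    carries it down one coordinate at a time. *)
Lemma A_top d j k : (d <= n)%N -> A n.+1 j * A (n.+1 - d) k = A (n.+1 - d) (j + k).
Proof.
elim: d j k => [|d IHd] j k dn; first by rewrite subn0 AM.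
have -> : (n.+1 - d.+1 = n - d)%N by [].
have E : (n - d).+1 = (n.+1 - d)%N by lia.
rewrite !(AS _ (leq_subr d n)) E mulrBr -scalerAr !IHd; try lia.
by rewrite addnS.
Qed.

(** A twist can be moved from one factor to the other. For d = 0 both sides reduce to [A m (j + k)]
    by [A_top]; the descent uses [AS] on the first factor. *)
Lemma A_mul_shift d m j k : (d <= n)%N -> (0 < m <= n.+1)%N ->
  A (n.+1 - d) j * A m k = A (n.+1 - d) 0 * A m (j + k).
Proof.
move=> + /andP[m0 mn]; elim: d j k => [|d IHd] j k dn.
  have -> : m = (n.+1 - (n.+1 - m))%N by lia.
  by rewrite subn0 !A_top ?add0n //; lia.
have -> : (n.+1 - d.+1 = n - d)%N by [].
have E : (n - d).+1 = (n.+1 - d)%N by lia.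
rewrite !(AS _ (leq_subr d n)) E.
rewrite !mulrBl -!scalerAl !(IHd j) ?(IHd j.+1) ?(IHd 1); try lia.
by rewrite add1n addSn.
Qed.

Lemma A_next w k : (w <= n)%N ->
  A w.+1 k.+1 = expc (eps w) *: (A w.+1 k - A w k).
Proof.
by move=> wn; rewrite (AS k wn) opprB addrC subrK scalerA expcK scale1r.
Qed.

(** One more step in d applies the operator 1 - e^{-eps_j} z with j = n - d. [A_mul_shift] moves z
    to the second factor, where [A_next] expresses it again in classes with k twists. *)
Lemma A_mul d v k : (d <= n)%N -> (v <= n)%N ->
  A (n.+1 - d) 0 * A v.+1 k = \sum_(0 <= w < n.+1) strc d v w *: A w.+1 k.
Proof.
elim: d k => [|d IHd] k dn vn.
  have -> : v.+1 = (n.+1 - (n - v))%N by lia.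
  rewrite subn0 A_top; last lia.
  have -> : (n.+1 - (n - v) = v.+1)%N by lia.
  rewrite (bigD1_seq v) ?mem_index_iota ?iota_uniq ?ltnS //=.
  rewrite eqxx scale1r big1 ?addr0 // => w wv.
  by rewrite eq_sym (negPf wv) scale0r.
have -> : (n.+1 - d.+1 = n - d)%N by [].
have E : (n - d).+1 = (n.+1 - d)%N by lia.
rewrite (AS _ (leq_subr d n)) E.
rewrite mulrBl -scalerAl (A_mul_shift 1 k (ltnW dn)) ?add1n ?(IHd k) ?(IHd k.+1); try lia.
pose B w := (strc d v w * expc (eps w - eps (n - d))) *: A w k.
transitivity (\sum_(0 <= w < n.+1)
    ((strc d v w * (1 - expc (eps w - eps (n - d)))) *: A w.+1 k + B w)).
  rewrite scaler_sumr -sumrB; apply: eq_big_nat => w /andP[_ wn].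
  rewrite A_next // /B !scalerA scalerBr mulrBr mulr1 scalerBl.
  rewrite expcD; set x := expc (eps w); set y := expc (- _).
  have -> : y * (strc d v w * x) = strc d v w * (x * y) by ring.
  by rewrite opprB addrA addrAC.
rewrite big_split /= [X in _ + X](_ : _ = \sum_(0 <= w < n.+1) B w.+1).
  by rewrite -big_split /=; apply: eq_bigr => w _; rewrite -scalerDl.
(* The two sums differ by a shift of the index. The end terms vanish: [B 0] because [A 0 k] is zero,
   [B n.+1] by [strc_eq0]. *)
rewrite big_nat_recl // [RHS]big_nat_recr //=.
rewrite {1}/B A0 scaler0 add0r [B n.+1](_ : _ = 0) ?addr0 //.
by rewrite /B strc_eq0 ?mul0r ?scale0r //; lia.
Qed.

End Structure.

(** * The twist by O(-1) and the Koszul relations *)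

Section LinearProp.
Variables (A : pzRingType) (U V : lmodType A) (f : U -> V).
Hypothesis lf : linear f.

Lemma linear_prop0 : f 0 = 0.
Proof. by rewrite -[X in f X](addNr 0) -scaleN1r lf scaleN1r addNr. Qed.

Lemma linear_propD : {morph f : x y / x + y}.
Proof. by move=> x y; rewrite -[x in LHS]scale1r lf scale1r. Qed.

Lemma linear_propZ a : {morph f : x / a *: x}.
Proof. by move=> x; rewrite -[_ *: x]addr0 lf linear_prop0 addr0. Qed.

Lemma linear_propB : {morph f : x y / x - y}.
Proof. by move=> x y; rewrite -!scaleN1r linear_propD linear_propZ. Qed.

Lemma linear_prop_sum (I : Type) (r : seq I) (P : pred I) (E : I -> U) :
  f (\sum_(i <- r | P i) E i) = \sum_(i <- r | P i) f (E i).
Proof. exact: (big_morph f linear_propD linear_prop0). Qed.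
End LinearProp.

Section Modules.
Variables (R : realType) (n : nat).
Local Notation C := R[i].
Local Notation torus := (torus R n).
Local Notation pt := (pt R).
Local Notation OU := (OU R).
Local Notation sheaf := (sheaf R n).
Implicit Types I J L : opn n.

Lemma OU_eqP (I : opn n) (f g : OU I) : val f =1 val g -> f = g.
Proof. by move=> /funext fg; exact: val_inj. Qed.

Lemma pt_neq0 (I : opn n) (x : pt I) i : i \in val I -> val x i != 0.
Proof. by have /forall_inP := valP x; apply. Qed.

Lemma OUX (I : opn n) (f : OU I) k x : val (f ^+ k) x = val f x ^+ k.
Proof. by elim: k => // k IHk; rewrite !exprS -IHk. Qed.

Definition ratioO (I : opn n) j i (iI : i \in val I) : OU I :=
  exist (is_regular R I) (fun x => val x j / val x i)
    (asboolT (@regular_ratio R n I i j iI)).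

(** An arbitrary index in I; its coordinate is a denominator valid on all of U_I. *)
Definition base (I : opn n) : 'I_n.+1 := xchoose (set0Pn _ (valP I)).

Lemma base_in I : base I \in val I.
Proof. exact: xchooseP. Qed.

Lemma base_incl I J : Defs.incl I J -> base I \in val J.
Proof. by move=> IJ; apply: (subsetP IJ); exact: base_in. Qed.

Lemma chi_eps (i : 'I_n.+1) (t : torus) : chi (eps n i) t = val t i.
Proof.
rewrite /chi (bigD1 i) //= ffunE eqxx expr1z big1 ?mulr1 // => j ji.
by rewrite ffunE val_eqE (negPf ji) expr0z.
Qed.

Section Zero.
Let zsec (I : opn n) : lmodType (OU I) := 'rV[OU I]_0.
Let zall (I : opn n) (m m' : zsec I) : m = m'.
Proof. by rewrite [m]thinmx0 [m']thinmx0. Qed.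

Definition zero_sheaf : sheaf.
Proof.
refine (@Sheaf R n zsec (fun _ _ _ _ => 0) (fun _ _ m => m) _ _ _ _ _ _ _ _ _ _ _ _ _)
  => *; try exact: zall.
- by exists 1; split; [exists 1; apply: OU_eqP => x; exact: mulr1|exact: zall].
- exists 1; split; first by exists 1; apply: OU_eqP => x; exact: mulr1.
  by exists 0; exact: zall.
- by exists 0%N, (fun=> 0) => m; exists (fun=> 0); exact: zall.
- by exists [::]; split=> //; exact: zall.
Defined.
End Zero.

(* O(-1) is trivialized on U_I by 1 / x_i with i = base I: the section m of F
   stands for m / x_i. *)
Section Serre.
Variable F : sheaf.

(** The transition function: with i = [base I] and j = [base J], m / x_i equals (x_j / x_i) m /
    x_j. *)
Definition transO I J (h : Defs.incl I J) : OU J :=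
  ratioO (base J) (base_incl h).

Definition serre_res I J (h : Defs.incl I J) (m : sec F I) : sec F J :=
  transO h *: res h m.

(** The torus acts on functions through t^-1, so 1 / x_i is multiplied by t_i. *)
Definition serre_act I (t : torus) (m : sec F I) : sec F I :=
  cstO I (val t (base I)) *: act t m.

Lemma serre_resD I J (h : Defs.incl I J) m m' :
  serre_res h (m + m') = serre_res h m + serre_res h m'.
Proof. by rewrite /serre_res resD scalerDr. Qed.

Lemma serre_resZ I J (h : Defs.incl I J) (f : OU I) m :
  serre_res h (f *: m) = resO h f *: serre_res h m.
Proof. by rewrite /serre_res resZ !scalerA mulrC. Qed.

Lemma serre_res_id I (h : Defs.incl I I) m : serre_res h m = m.
Proof.
rewrite /serre_res res_id (_ : transO h = 1) ?scale1r //.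
by apply: OU_eqP => x; rewrite /= divff ?pt_neq0 ?base_in.
Qed.

Lemma serre_res_comp I J L (h : Defs.incl I J) (h' : Defs.incl J L)
    (h'' : Defs.incl I L) m :
  serre_res h' (serre_res h m) = serre_res h'' m.
Proof.
rewrite /serre_res resZ (res_comp h h' h'') scalerA; congr (_ *: _).
apply: OU_eqP => x; rewrite [LHS](_ : _ =
  val x (base L) / val x (base J) * (val x (base J) / val x (base I))) //.
by rewrite mulrA divfK ?pt_neq0 ?base_incl.
Qed.

Lemma transO_unit I J (h : Defs.incl I J) : exists g, g * transO h = 1.
Proof.
exists (ratioO (base I) (base_in J)); apply: OU_eqP => x.
rewrite [LHS](_ : _ =
  val x (base I) / val x (base J) * (val x (base J) / val x (base I))) //.
by rewrite mulrA divfK ?divff ?pt_neq0 ?base_in ?base_incl.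
Qed.

Lemma serre_res_ker I J (h : Defs.incl I J) m : serre_res h m = 0 ->
  exists f : OU I, (exists g : OU J, g * resO h f = 1) /\ f *: m = 0.
Proof.
have [g gt] := transO_unit h.
by move=> /(congr1 ( *:%R g)); rewrite scalerA gt scale1r scaler0 => /res_ker.
Qed.

Lemma serre_res_frac I J (h : Defs.incl I J) (m : sec F J) :
  exists f : OU I, (exists g : OU J, g * resO h f = 1) /\
    (exists m' : sec F I, resO h f *: m = serre_res h m').
Proof.
have [g gt] := transO_unit h; have [f [fU [m' E]]] := res_frac h (g *: m).
exists f; split=> //; exists m'; rewrite /serre_res -E !scalerA.
by rewrite mulrC mulrA gt mul1r.
Qed.

Lemma serre_actD I t (m m' : sec F I) :
  serre_act t (m + m') = serre_act t m + serre_act t m'.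
Proof. by rewrite /serre_act actD scalerDr. Qed.

Lemma serre_actZ I t (f : OU I) (m : sec F I) :
  serre_act t (f *: m) = actO t f *: serre_act t m.
Proof. by rewrite /serre_act actZ !scalerA mulrC. Qed.

Lemma serre_act1 I (m : sec F I) : serre_act (tone R n) m = m.
Proof. by rewrite /serre_act act1 ffunE cstO1 scale1r. Qed.

Lemma serre_actM I s t (m : sec F I) :
  serre_act (tmul s t) m = serre_act s (serre_act t m).
Proof. by rewrite /serre_act actZ actO_cst actM scalerA ffunE cstOM. Qed.

Lemma serre_act_res I J (h : Defs.incl I J) t (m : sec F I) :
  serre_act t (serre_res h m) = serre_res h (serre_act t m).
Proof.
rewrite /serre_act /serre_res actZ resZ act_res !scalerA; congr (_ *: _).
apply: OU_eqP => x; rewrite [LHS](_ : _ =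
  val t (base J) * (val (ptt (tinv t) x) (base J) / val (ptt (tinv t) x) (base I))) //.
rewrite [RHS](_ : _ = val x (base J) / val x (base I) * val t (base I)) //.
rewrite !ffunE !invfM invrK !mulrA mulfV ?torus_neq0 // mul1r.
by rewrite mulrAC.
Qed.

Lemma serre_act_alg I (m : sec F I) : exists s : seq (weight n * sec F I),
  {in s, forall p t, serre_act t p.2 = cstO I (chi p.1 t) *: p.2} /\
  m = \sum_(p <- s) p.2.
Proof.
have [s [sw ->]] := act_alg m; exists [seq (eps n (base I) + p.1, p.2) | p <- s].
split; last by rewrite big_map.
move=> _ /mapP[p ps ->] t /=.
by rewrite /serre_act sw // scalerA chiD chi_eps cstOM.
Qed.

Definition serre : sheaf :=
  Sheaf serre_resD serre_resZ serre_res_id serre_res_comp serre_res_ker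
    serre_res_frac (@sec_fg _ _ F) serre_actD serre_actZ serre_act1 serre_actM
    serre_act_res serre_act_alg.

End Serre.

Lemma serre_short_exact F' F F'' :
  short_exact F' F F'' -> short_exact (serre F') (serre F) (serre F'').
Proof.
have hom (E G : sheaf) (phi : forall I, sec E I -> sec G I) :
    is_hom phi -> is_hom (phi : forall I, sec (serre E) I -> sec (serre G) I).
  move=> [lin pres pact].
  split=> // [I J h m|I t m] /=.
    by rewrite /serre_res (linear_propZ (lin J)) pres.
  by rewrite /serre_act (linear_propZ (lin I)) pact.
by move=> [phi [psi [/hom hphi [/hom hpsi ex]]]]; exists phi, psi.
Qed.

(** The same [beta] serves: [serre] keeps the module on each chart, hence the universal property,
    and the new factors in restriction and action come out of the first argument. *)
Lemma serre_tensor E F G : is_tensor E F G -> is_tensor (serre E) F (serre G).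
Proof.
move=> [beta [bil [bres [bact buniv]]]]; exists beta; split=> //.
have bZ I (f : OU I) e m : beta I (f *: e) m = f *: beta I e m.
  exact: (linear_propZ ((bil I).1 m)).
split; last split=> //.
  by move=> I J h e f; rewrite /= /serre_res bZ bres.
by move=> I t e f; rewrite /= /serre_act bZ bact.
Qed.

Lemma res0 (F : sheaf) I J (h : Defs.incl I J) : res h (0 : sec F I) = 0.
Proof. by apply: (addrI (res h 0)); rewrite -resD !addr0. Qed.

Lemma act0 (F : sheaf) I t : act t (0 : sec F I) = 0.
Proof. by apply: (addrI (act t 0)); rewrite -actD !addr0. Qed.

Lemma zero_sheaf_all (I : opn n) (m m' : sec zero_sheaf I) : m = m'.
Proof.
have all_eq (u v : 'rV[OU I]_0) : u = v by rewrite [u]thinmx0 [v]thinmx0.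
exact: all_eq.
Qed.

Lemma hom_from_zero (F : sheaf) : is_hom (fun I (_ : sec zero_sheaf I) => 0 : sec F I).
Proof. by split=> [I a m m'|I J h m|I t m]; rewrite ?scaler0 ?addr0 ?res0 ?act0. Qed.

Lemma short_exact_zero : short_exact zero_sheaf zero_sheaf zero_sheaf.
Proof.
exists (fun _ => id), (fun _ => id).
do 2 (split; first by split=> [I a m m'|I J h m|I t m]; exact: zero_sheaf_all).
move=> I; split=> [m m' _|m|m]; first exact: zero_sheaf_all.
  by split=> _; [exists m|]; exact: zero_sheaf_all.
by exists m.
Qed.

(** Puts an isomorphism in the form of an exact sequence, from which [KT_exact] yields equality of
    classes. *)
Lemma short_exact_iso (F G : sheaf) (phi : forall I, sec F I -> sec G I) :
  is_hom phi -> (forall I, bijective (phi I)) -> short_exact zero_sheaf F G.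
Proof.
move=> hphi bij; exists (fun _ _ => 0), phi; split; first exact: hom_from_zero.
split=> // I; split=> [m m' _|m|m]; first exact: zero_sheaf_all.
  have p0 : phi I 0 = 0 by case: hphi => lin _ _; exact: (linear_prop0 (lin I)).
  split=> [|[_ ->] //]; rewrite -[X in _ = X]p0 => /(bij_inj (bij I)) ->.
  by exists 0.
by have [psi _ psiK] := bij I; exists (psi m).
Qed.

Lemma serre_twist l (F : sheaf) :
  short_exact zero_sheaf (serre (twist l F)) (twist l (serre F)).
Proof.
apply: (@short_exact_iso (serre (twist l F)) (twist l (serre F)) (fun _ => id));
  last by move=> I; exists id.
split=> // I t m /=.
by rewrite /serre_act /twist_act /= /twist_act /serre_act !scalerA mulrC.
Qed.

(** * The structure sheaf of the whole space as the unit of the tensor product *)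

Section Full.

Lemma in_X_max I (x : pt I) : in_X (ord_max : 'I_n.+1) x.
Proof. by apply/forallP => j; rewrite ltnNge -ltnS ltn_ord. Qed.

Definition xfull I (x : pt I) : xpt R (@ord_max n) I :=
  exist (@in_X R n ord_max I) x (in_X_max x).

Lemma xfull_val I (x : xpt R (@ord_max n) I) : xfull (val x) = x.
Proof. exact: val_inj. Qed.

Lemma fullO_subproof I (g : OXsec R (@ord_max n) I) :
  is_regular R I (fun x => val g (xfull x)).
Proof.
have /asboolP[f gf] := valP g.
have -> : (fun x => val g (xfull x)) = val f by apply: funext => x; rewrite gf.
exact: valP.
Qed.
Definition fullO I (g : OXsec R (@ord_max n) I) : OU I :=
  exist (is_regular R I) _ (fullO_subproof g).

Lemma oneX_subproof I : @is_xregular R n ord_max I (fun=> 1).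
Proof. by apply/asboolP; exists 1. Qed.
Definition oneX I : OXsec R (@ord_max n) I :=
  exist (@is_xregular R n ord_max I) _ (oneX_subproof I).

Lemma fullO_oneX I (g : OXsec R (@ord_max n) I) : g = fullO g *: oneX I.
Proof.
apply: OXsec_eqP => x.
by rewrite [RHS](_ : _ = val g (xfull (val x)) * 1) // mulr1 xfull_val.
Qed.

Lemma oneX_fullO I (f : OU I) : fullO (f *: oneX I) = f.
Proof. by apply: OU_eqP => x; exact: mulr1. Qed.

Lemma OX_max_locally_free : locally_free (OX R (@ord_max n)).
Proof.
move=> I x; exists 1; split; first exact: oner_neq0.
exists 1%N, (fun=> oneX I); split=> [m|a].
  by exists 0%N, (fun=> fullO m); rewrite big_ord1 expr0 scale1r -fullO_oneX.
rewrite big_ord1 => a0 j; exists 0%N; rewrite mul1r ord1 -[a 0]oneX_fullO a0.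
exact: OU_eqP.
Qed.

(** Scalar multiplication is the universal bilinear map, because [gamma] is determined by its values
    at [oneX]. *)
Lemma OX_max_tensor F : is_tensor (OX R (@ord_max n)) F F.
Proof.
exists (fun I g m => fullO g *: m); split; last split; last split.
- move=> I; split=> [m a g k|g a m m'].
    rewrite (_ : fullO (a *: g + k) = a * fullO g + fullO k).
      by rewrite scalerDl scalerA.
    exact: OU_eqP.
  by rewrite scalerDr !scalerA mulrC.
- move=> I J h g m; rewrite resZ; congr (_ *: _); apply: OU_eqP => x.
  by rewrite [LHS]/= [RHS]/=; apply: congr1; exact/val_inj/val_inj.
- move=> I t g m; rewrite actZ; congr (_ *: _); apply: OU_eqP => x.
  by rewrite [LHS]/= [RHS]/=; apply: congr1; exact/val_inj/val_inj.
- move=> I N gamma [gl gr]; exists (gamma (oneX I)).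
    split; first exact: gr.
    by move=> g m; rewrite (linear_propZ (gr _)) -(linear_propZ (gl _)) -fullO_oneX.
  move=> g' [_ g'E] m; rewrite -g'E.
  by rewrite -[oneX I]scale1r oneX_fullO scale1r.
Qed.
End Full.

(** * Multiplication by a coordinate and its exact sequences *)

Section Koszul.
Variable w : 'I_n.+1.

(** Multiplication by x_w from O(-1) to O, read in the trivialization 1 / x_i with i = [base I]. *)
Definition coord I : OU I := ratioO w (base_in I).

Lemma coord_unit I : w \in val I -> exists d, d * coord I = 1.
Proof.
move=> wI; exists (ratioO (base I) wI); apply: OU_eqP => x.
rewrite [LHS](_ : _ = val x (base I) / val x w * (val x w / val x (base I))) //.
by rewrite mulrA divfK ?divff ?pt_neq0 ?base_in.
Qed.

(** * Varying x_w freely inside U_I when w is not in I *)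

Section Line.
Variables (I : opn n) (wI : w \notin val I).

Lemma repl_subproof (x : pt I) (s : C) :
  in_U I [ffun k => if k == w then s else val x k].
Proof.
apply/forall_inP => k kI; rewrite ffunE; case: (k =P w) => [kw|_]; last exact: pt_neq0.
by rewrite kw (negPf wI) in kI.
Qed.
Definition repl (x : pt I) (s : C) : pt I := exist (in_U I) _ (repl_subproof x s).

Lemma repl_in_X (x : pt I) s : in_X w x -> in_X w (repl x s).
Proof.
move=> /forallP xX; apply/forallP => j; apply/implyP => wj.
rewrite ffunE; case: (j =P w) => [jw|_]; first by rewrite jw ltnn in wj.
by have /implyP := xX j; exact.
Qed.

Lemma repl_id (x : pt I) : repl x (val x w) = x.
Proof. by apply/val_inj/ffunP => k; rewrite ffunE; case: eqP => [->|]. Qed.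

Lemma repl_base (x : pt I) s i : i \in val I -> val (repl x s) i = val x i.
Proof.
by move=> iI; rewrite ffunE; case: (i =P w) iI => // ->; rewrite (negPf wI).
Qed.

(** Only coordinates with index in I occur as denominators, and w is not among them. *)
Lemma regular_line (f : OU I) (x : pt I) :
  exists p : {poly C}, forall s, val f (repl x s) = p.[s].
Proof.
have /asboolP := valP f; elim=> [c|i j iI|g k _ [p gp] _ [q kq]|g k _ [p gp] _ [q kq]].
- by exists c%:P => s; rewrite hornerC.
- have [->|jw] := eqVneq j w.
    exists ((val x i)^-1 *: 'X) => s; rewrite hornerZ hornerX (repl_base _ _ iI) mulrC.
    by rewrite ffunE eqxx.
  exists (val x j / val x i)%:P => s; rewrite hornerC (repl_base _ _ iI).
  by rewrite ffunE (negPf jw).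
- by exists (p + q) => s; rewrite hornerD gp kq.
- by exists (p * q) => s; rewrite hornerM gp kq.
Qed.

Lemma regular_divide (f : OU I) :
  exists g : OU I, forall x, val f x - val f (repl x 0) = val (coord I) x * val g x.
Proof.
suff H : forall f : pt I -> C, regular f -> exists g : pt I -> C, regular g /\
    forall x, f x - f (repl x 0) = val (coord I) x * g x.
  have /asboolP/H[g [gr E]] := valP f.
  by exists (exist (is_regular R I) g (asboolT gr)).
move=> {}f; elim=> [c|i j iI|g k gr [g' [gr' gE]] kr [k' [kr' kE]]
                   |g k gr [g' [gr' gE]] kr [k' [kr' kE]]].
- by exists (fun=> 0); split=> [|x]; [exact: regular_cst|rewrite subrr mulr0].
- have [->|jw] := eqVneq j w.
    exists (fun x : pt I => val x (base I) / val x i); split; first exact: regular_ratio.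
    move=> x; rewrite (repl_base _ _ iI) ffunE eqxx mul0r subr0 /= mulrA divfK //.
    exact/pt_neq0/base_in.
  exists (fun=> 0); split=> [|x]; first exact: regular_cst.
  by rewrite (repl_base _ _ iI) ffunE (negPf jw) subrr mulr0.
- exists (fun x => g' x + k' x); split=> [|x]; first exact: regular_add.
  by rewrite opprD addrACA gE kE mulrDr.
(* From gk - g_0 k_0 = (g - g_0) k + g_0 (k - k_0), where the index 0 means x_w = 0, with g_0
   rewritten as g - [coord] g' so that the quotient is visibly regular. *)
- exists (fun x => g' x * k x + (g x + (-1 * val (coord I) x) * g' x) * k' x).
  split=> [|x].
    apply: regular_add; apply: regular_mul => //; apply: regular_add => //.
    apply: regular_mul => //; apply: regular_mul; first exact: regular_cst.
    exact/regular_ratio/base_in.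
  have gx : g (repl x 0) = g x - val (coord I) x * g' x by rewrite -gE subKr.
  have kx : k (repl x 0) = k x - val (coord I) x * k' x by rewrite -kE subKr.
  rewrite gx kx; move: (val _ x) => c; ring.
Qed.

End Line.

Lemma poly_vanish (p : {poly C}) : (forall s, s != 0 -> p.[s] = 0) -> p = 0.
Proof.
move=> p0; apply: (@roots_geq_poly_eq0 _ p [seq k.+1%:R | k <- iota 0 (size p)]).
- by apply/allP => _ /mapP[k _ ->]; apply/rootP; rewrite p0 // pnatr_eq0.
- by rewrite map_inj_uniq ?iota_uniq // => i j /eqP; rewrite eqr_nat => /eqP[].
- by rewrite size_map size_iota.
Qed.

(** If w is in I, x_w is invertible. Otherwise, along each line in the direction of x_w, both
    functions are polynomials that agree where x_w is nonzero, hence everywhere. *)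
Lemma coord_inj I : injective (fun g : OXsec R w I => coord I *: g).
Proof.
move=> g k /= E; have [/coord_unit[d dU]|wI] := boolP (w \in val I).
  by move/(congr1 ( *:%R d)): E; rewrite !scalerA dU !scale1r.
have /asboolP[f gf] := valP g; have /asboolP[f' kf] := valP k.
apply: OXsec_eqP => x; rewrite gf kf.
have [p pE] := regular_line wI f (val x); have [q qE] := regular_line wI f' (val x).
rewrite -(repl_id wI (val x)) pE qE; congr (_.[_]); apply/eqP.
rewrite -subr_eq0; apply/eqP/poly_vanish => s s0; rewrite hornerD hornerN -pE -qE.
pose y : xpt R w I := exist (@in_X R n w I) _ (repl_in_X wI s (valP x)).
have := congr1 (fun h : OXsec R w I => val h y) E.
rewrite [LHS](_ : _ = val (coord I) (val y) * val g y) //.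
rewrite [RHS](_ : _ = val (coord I) (val y) * val k y) //.
rewrite gf kf => /mulfI -> //; first by rewrite subrr.
rewrite [val (coord I) _](_ : _ = val (val y) w / val (val y) (base I)) //.
rewrite [val (val y) w](_ : _ = s); last by rewrite ffunE eqxx.
by rewrite mulf_neq0 ?invr_neq0 ?pt_neq0 ?base_in.
Qed.

(** When w is not in I, [regular_divide] applies to an extension f of g: the remainder is a value of
    g at a point of X_w with x_w = 0, so it vanishes. *)
Lemma coord_ker I (g : OXsec R w I) :
  (forall x : xpt R w I, val (val x) w = 0 -> val g x = 0) <->
  exists k : OXsec R w I, g = coord I *: k.
Proof.
split=> [g0|[k -> x xw]]; last first.
  rewrite [LHS](_ : _ = val (val x) w / val (val x) (base I) * val k x) //.
  by rewrite xw !mul0r.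
have [/coord_unit[d dU]|wI] := boolP (w \in val I).
  by exists (d *: g); rewrite scalerA mulrC dU scale1r.
have /asboolP[f gf] := valP g; have [f' f'E] := regular_divide wI f.
exists (exist (@is_xregular R n w I) (fun x => val f' (val x))
  (asboolT (ex_intro _ f' (fun=> erefl)))).
apply: OXsec_eqP => x; rewrite [RHS](_ : _ = val (coord I) (val x) * val f' (val x)) //.
rewrite -f'E gf [X in _ - X](_ : _ = 0) ?subr0 //.
pose y : xpt R w I := exist (@in_X R n w I) _ (repl_in_X wI 0 (valP x)).
by have := g0 y; rewrite gf => -> //; rewrite ffunE eqxx.
Qed.

(** The function x_w has weight -eps_w; the twist compensates for it and makes the multiplication
    equivariant. *)
Lemma coord_hom : is_hom (F := twist (- eps n w) (serre (OX R w))) (G := OX R w)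
  (fun I (m : OXsec R w I) => coord I *: m).
Proof.
split=> [I a m m'|I J h m|I t m].
- apply: (@OXsec_eqP R n w I) => x.
  exact: etrans (mulrDr _ _ _) (congr1 (+%R^~ _) (mulrCA _ _ _)).
- rewrite [RHS]resZ [LHS]scalerA; congr (_ *: _); apply: OU_eqP => x.
  rewrite [LHS](_ : _ = val x w / val x (base J) * (val x (base J) / val x (base I))) //.
  by rewrite mulrA divfK ?pt_neq0 ?base_in.
- rewrite [RHS]actZ [LHS]scalerA [LHS]scalerA; congr (_ *: _); apply: OU_eqP => x.
  rewrite [LHS](_ : _ = val x w / val x (base I) * chi (- eps n w) t * val t (base I)) //.
  rewrite [RHS](_ : _ = val (ptt (tinv t) x) w / val (ptt (tinv t) x) (base I)) //.
  have -> : chi (- eps n w) t = (val t w)^-1.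
    apply: (mulfI (torus_neq0 t w)); rewrite divff ?torus_neq0 //.
    by rewrite -{1}(chi_eps w t) -chiD subrr chi0.
  rewrite !ffunE invfM invrK.
  move: (val t w)^-1 (val t (base I)) (val x w) (val x (base I))^-1 => a b c d.
  by ring.
Qed.

(** The point X_0 does not meet x_0 = 0, so the vanishing condition in [coord_ker] is vacuous and
    multiplication is onto. *)
Lemma koszul0 : w = 0 :> nat ->
  short_exact zero_sheaf (twist (- eps n w) (serre (OX R w))) (OX R w).
Proof.
move=> w0; apply: (short_exact_iso coord_hom) => I.
have ex (g : OXsec R w I) : exists k, g = coord I *: k.
  apply/coord_ker => x xw; have /negP[] := pt_neq0 (val x) (base_in I).
  have [->|bw] := eqVneq (base I) w; first exact/eqP.
  have /forallP/(_ (base I))/implyP := valP x; apply.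
  by rewrite w0 lt0n; apply: contra bw => /eqP b0; apply/eqP/val_inj; rewrite /= w0.
exists (fun g => projT1 (cid (ex g))) => g; first by apply: coord_inj; case: cid.
by case: cid.
Qed.

Section Restriction.
Variables (v : 'I_n.+1) (vw : v.+1 = w :> nat).

Lemma in_X_succ I (x : pt I) : in_X v x = in_X w x && (val x w == 0).
Proof.
apply/idP/andP=> [/forallP xX|[/forallP xX xw]].
  split; last by have /implyP := xX w; apply; rewrite -vw.
  apply/forallP => j; apply/implyP => wj; have /implyP := xX j; apply.
  by rewrite ltnW // vw.
apply/forallP => j; apply/implyP; rewrite leq_eqVlt => /orP[/eqP vj|vj].
  by rewrite (_ : j = w) //; apply: val_inj; rewrite /= -vj.
by have /implyP := xX j; apply; rewrite -vw.
Qed.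

Lemma xinc_subproof I (x : xpt R v I) : in_X w (val x).
Proof. by have := valP x; rewrite [in_X _ _]in_X_succ => /andP[]. Qed.
Definition xinc I (x : xpt R v I) : xpt R w I :=
  exist (@in_X R n w I) _ (xinc_subproof x).

Lemma restr_subproof I (g : OXsec R w I) : @is_xregular R n v I (fun x => val g (xinc x)).
Proof. by have /asboolP[f gf] := valP g; apply/asboolP; exists f => x; rewrite gf. Qed.
Definition restr I (g : OXsec R w I) : OXsec R v I :=
  exist (@is_xregular R n v I) _ (restr_subproof g).

Lemma restr_hom : is_hom (F := OX R w) (G := OX R v) restr.
Proof.
split=> [I a m m'|I J h m|I t m]; apply: OXsec_eqP => x //.
  by rewrite [LHS]/= [RHS]/=; apply: congr1; exact/val_inj/val_inj.
by rewrite [LHS]/= [RHS]/=; apply: congr1; exact/val_inj/val_inj.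
Qed.

Lemma koszulS :
  short_exact (twist (- eps n w) (serre (OX R w))) (OX R w) (OX R v).
Proof.
exists (fun I (m : OXsec R w I) => coord I *: m), restr.
split; first exact: coord_hom.
split; first exact: restr_hom.
move=> I; split; first exact: coord_inj.
  move=> g; apply: iff_trans (coord_ker g); split=> [g0 x xw|g0].
    have xv : in_X v (val x) by rewrite in_X_succ (valP x) xw eqxx.
    transitivity (val (restr g) (exist (@in_X R n v I) _ xv)); last by rewrite g0.
    by rewrite [RHS]/=; apply: congr1; exact: val_inj.
  apply: OXsec_eqP => x; apply: g0.
  by have := valP x; rewrite [in_X _ _]in_X_succ => /andP[_ /eqP].
move=> g; have /asboolP[f gf] := valP g.
exists (exist (@is_xregular R n w I) (fun x => val f (val x))
  (asboolT (ex_intro _ f (fun=> erefl)))).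
by apply: OXsec_eqP => x; rewrite gf.
Qed.
End Restriction.

End Koszul.

End Modules.

(** * The classes of iterated twists satisfy the relations assumed for [A] *)

Section Classes.
Variables (R : realType) (n : nat).
Variables (K : comAlgType (RT R n)) (cls : sheaf R n -> K) (hK : is_KT cls).

Lemma serre_iter_exact k F' F F'' : short_exact F' F F'' ->
  short_exact (iter k (@serre R n) F') (iter k (@serre R n) F) (iter k (@serre R n) F'').
Proof. by elim: k => //= k IHk /IHk; exact: serre_short_exact. Qed.

Lemma cls_serre_zero k : cls (iter k (@serre R n) (zero_sheaf R n)) = 0.
Proof.
apply: (addrI (cls (iter k (@serre R n) (zero_sheaf R n)))).
by rewrite -(KT_exact hK (serre_iter_exact k (short_exact_zero R n))) addr0.
Qed.

Lemma cls_iso F G : short_exact (zero_sheaf R n) F G -> cls F = cls G.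
Proof. by move=> /(KT_exact hK); rewrite (cls_serre_zero 0) add0r. Qed.

Lemma cls_serre_twist k l F :
  cls (iter k (@serre R n) (twist l F)) = expc R l *: cls (iter k (@serre R n) F).
Proof.
suff -> : cls (iter k (@serre R n) (twist l F)) = cls (twist l (iter k (@serre R n) F)).
  by rewrite KT_scale.
(* The twist is exact, so it descends to an operator on K; equalities of classes may therefore be
   twisted. *)
have [S SE] : exists S : {additive K -> K}, forall F, S (cls F) = cls (serre F).
  apply: (KT_universal hK (phi := fun F => cls (serre F))) => F1 F2 F3.
  by move=> /serre_short_exact/(KT_exact hK).
elim: k => //= k IHk.
by rewrite -SE IHk SE; apply: cls_iso; exact: serre_twist.
Qed.

(** The instance of [A]: m coordinates span X_{m-1}, and the empty subspace has class 0. *)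
Definition coordcls (m k : nat) : K :=
  if m is m'.+1 then cls (iter k (@serre R n) (OX R (inord m'))) else 0.

Lemma coordcls0 k : coordcls 0 k = 0. Proof. by []. Qed.

Lemma coordclsS m k : (m <= n)%N ->
  coordcls m k = coordcls m.+1 k - expc R (- eps n m) *: coordcls m.+1 k.+1.
Proof.
move=> mn; rewrite /= -/(iter k.+1 (@serre R n) _) iterSr -cls_serre_twist.
have mE : (inord m : 'I_n.+1) = m :> nat by rewrite inordK.
case: m mn mE => [|m] mn mE.
  have := koszul0 R mE; rewrite mE => /(serre_iter_exact k)/(KT_exact hK) ->.
  by rewrite cls_serre_zero add0r subrr.
have := @koszulS R n (inord m.+1) (inord m).
rewrite mE inordK; last exact: ltnW.
move=> /(_ erefl)/(serre_iter_exact k)/(KT_exact hK) ->.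
by rewrite addrAC subrr add0r.
Qed.

(** Local freeness is inherited from O because [serre] keeps the modules; the tensor product follows
    by twisting its unit. *)
Lemma coordclsM j k : coordcls n.+1 j * coordcls n.+1 k = coordcls n.+1 (j + k).
Proof.
rewrite /= (_ : inord n = ord_max); last by apply: val_inj; rewrite /= inordK.
rewrite iterD; apply: (KT_tensor hK).
- by elim: j => //; exact: OX_max_locally_free.
- by elim: k => //; exact: OX_max_locally_free.
- elim: j => [|j IHj]; first exact: OX_max_tensor.
  exact: serre_tensor.
Qed.

End Classes.

(** * Dimensions of subspaces of modules over a field *)

Section Dimension.
Variable k : fieldType.

Fixpoint in_span (V : lmodType k) (s : seq V) (v : V) : Prop :=
  if s is x :: s' then exists a w, in_span s' w /\ v = a *: x + w else v = 0.

Lemma in_span_lin (V : lmodType k) (s : seq V) a u v :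
  in_span s u -> in_span s v -> in_span s (a *: u + v).
Proof.
elim: s u v => [|x s IHs] u v /=; first by move=> -> ->; rewrite scaler0 addr0.
move=> [b [u' [su ->]]] [c [v' [sv ->]]]; exists (a * b + c), (a *: u' + v').
by split; [exact: IHs|rewrite scalerDr scalerA scalerDl addrACA].
Qed.

Lemma in_span0 (V : lmodType k) (s : seq V) : in_span s 0.
Proof.
elim: s => //= x s IHs; exists 0, 0; split=> //.
by rewrite scale0r addr0.
Qed.

Lemma in_span_mem (V : lmodType k) (s : seq V) x : x \in s -> in_span s x.
Proof.
elim: s => //= y s IHs; rewrite inE => /orP[/eqP->|xs].
  by exists 1, 0; split; [exact: in_span0|rewrite scale1r addr0].
by exists 0, x; split; [exact: IHs|rewrite scale0r add0r].
Qed.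

Definition subspace (V : lmodType k) (W : V -> Prop) :=
  W 0 /\ forall a u v, W u -> W v -> W (a *: u + v).

(** A basis of a subspace given by a predicate, since the ambient space may have infinite
    dimension. *)
Definition has_dim (V : lmodType k) (W : V -> Prop) (d : nat) :=
  exists e : 'I_d -> V,
    (forall v, W v <-> exists a : 'I_d -> k, v = \sum_j a j *: e j) /\
    (forall a : 'I_d -> k, \sum_j a j *: e j = 0 -> forall j, a j = 0).

(** If d' < d, the matrix writing [e] in terms of [e'] has more rows than columns, and a row vector
    in its kernel is a relation among the [e]. *)
Lemma has_dim_leq (V : lmodType k) (W : V -> Prop) d d' :
  has_dim W d -> has_dim W d' -> (d <= d')%N.
Proof.
move=> [e [eW efree]] [e' [e'W _]]; rewrite leqNgt; apply/negP => dd'.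
have /choice[A AE] i : exists a : 'I_d' -> k, e i = \sum_j a j *: e' j.
  apply/e'W/eW; exists (fun j => (j == i)%:R).
  rewrite (bigD1 i) //= eqxx scale1r big1 ?addr0 // => j /negPf ->.
  by rewrite scale0r.
pose M := \matrix_(i, j) A i j.
have : kermx M != 0.
  rewrite kermx_eq0 /row_free neq_ltn; apply/orP; left.
  exact: leq_ltn_trans (rank_leq_col _) dd'.
move=> /rowV0Pn[u /sub_kermxP uM /negP[]]; apply/eqP/rowP => i; rewrite mxE.
apply: (efree (fun i => u 0 i)).
under eq_bigr do rewrite AE scaler_sumr.
rewrite exchange_big big1 //= => j _.
under eq_bigr do rewrite scalerA.
rewrite -scaler_suml; have /matrixP/(_ 0 j) := uM; rewrite !mxE.
by under eq_bigr do rewrite mxE; move=> ->; rewrite scale0r.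
Qed.

Lemma has_dim_uniq (V : lmodType k) (W : V -> Prop) d d' :
  has_dim W d -> has_dim W d' -> d = d'.
Proof.
by move=> Wd Wd'; apply/eqP; rewrite eqn_leq !(has_dim_leq (W := W)).
Qed.

Lemma subspace_sum (V : lmodType k) (W : V -> Prop) (I : finType) (a : I -> k)
  (e : I -> V) : subspace W -> (forall j, W (e j)) -> W (\sum_j a j *: e j).
Proof.
move=> [W0 Wl] We; apply: (big_ind W) => // [u v Wu Wv|j _].
  by rewrite -[u]scale1r; exact: Wl.
by rewrite -[_ *: _]addr0; exact: Wl.
Qed.

Lemma has_dim_in_span (V : lmodType k) (W : V -> Prop) (s : seq V) :
  subspace W -> (forall v, W v -> in_span s v) -> exists d, has_dim W d.
Proof.
elim: s W => [|x s IHs] W subW Ws; have [W0 Wl] := subW.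
  exists 0%N, (fun=> 0); split=> [v|a _ []//]; split=> [/Ws ->|[a ->]].
    by exists (fun=> 0); rewrite big_ord0.
  by rewrite big_ord0.
pose W' v := W v /\ in_span s v.
have subW' : subspace W'.
  split; first by split=> //; exact: in_span0.
  by move=> a u v [Wu su] [Wv sv]; split; [exact: Wl|exact: in_span_lin].
have [d [e [eW efree]]] := IHs W' subW' (fun v => @proj2 _ _).
have We j : W (e j).
  suff : W' (e j) by case.
  apply/eW; exists (fun i => (i == j)%:R).
  rewrite (bigD1 j) //= eqxx scale1r big1 ?addr0 // => i /negPf ->.
  by rewrite scale0r.
(* Either W lies in the span of s, or some y in W has a nonzero coefficient b at x. Then y extends a
   basis of [W'], as subtracting (c / b) y removes the x-component of a vector of W. *)
have [Wall|/existsNP[y /not_implyP[Wy nsy]]] := pselect (forall v, W v -> in_span s v).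
  exists d, e; split=> // v; rewrite -eW.
  by split=> [Wv|[]//]; split=> //; exact: Wall.
have [b [z [sz yE]]] := Ws _ Wy.
have b0 : b != 0 by apply/eqP => b0; apply: nsy; rewrite yE b0 scale0r add0r.
exists d.+1, (fun i => if unlift ord0 i is Some j then e j else y).
have sumE (a : 'I_d.+1 -> k) :
    \sum_i a i *: (if unlift ord0 i is Some j then e j else y)
    = a ord0 *: y + \sum_j a (lift ord0 j) *: e j.
  rewrite big_ord_recl unlift_none; congr (_ + _).
  by apply: eq_bigr => j _; rewrite liftK.
split=> [v|a].
  split=> [Wv|[a ->]]; last first.
    by rewrite sumE; apply: Wl => //; exact: subspace_sum.
  have [c [u [su vE]]] := Ws _ Wv.
  have : W' (v - (c / b) *: y).
    split; first by rewrite addrC -scaleNr; exact: Wl.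
    rewrite vE yE scalerDr scalerA divfK // opprD addrACA subrr add0r addrC -scaleNr.
    exact: in_span_lin.
  move=> /eW[a aE].
  exists (fun i => if unlift ord0 i is Some j then a j else c / b).
  rewrite sumE unlift_none; under eq_bigr do rewrite liftK.
  by rewrite -aE addrC subrK.
rewrite sumE => a0.
have e_in : in_span s (\sum_j a (lift ord0 j) *: e j).
  suff : W' (\sum_j a (lift ord0 j) *: e j) by case.
  by apply/eW; exists (fun j => a (lift ord0 j)).
have a00 : a ord0 = 0.
  apply/eqP/negPn/negP => an0; apply: nsy.
  rewrite (_ : y = (- (a ord0)^-1) *: (\sum_j a (lift ord0 j) *: e j) + 0).
    by apply: in_span_lin => //; exact: in_span0.
  move/eqP: a0; rewrite addrC addr_eq0 => /eqP ->.
  by rewrite addr0 scaleNr scalerN opprK scalerA mulVf // scale1r.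
move: a0; rewrite a00 scale0r add0r => /efree ae j.
by case: (unliftP ord0 j) => [i ->|->].
Qed.

(** The images of a basis of [W'] together with lifts of a basis of [W''] form a basis of [W]. *)
Lemma has_dim_exact (V' V V'' : lmodType k) (phi : V' -> V) (psi : V -> V'')
    (W' : V' -> Prop) (W : V -> Prop) (W'' : V'' -> Prop) d' d'' :
  linear phi -> linear psi -> injective phi -> subspace W ->
  (forall v, W' v -> W (phi v)) ->
  (forall v, W v -> W'' (psi v)) ->
  (forall v, W v -> psi v = 0 -> exists2 u, W' u & v = phi u) ->
  (forall v, psi (phi v) = 0) ->
  (forall u, W'' u -> exists2 v, W v & psi v = u) ->
  has_dim W' d' -> has_dim W'' d'' -> has_dim W (d' + d'').
Proof.
move=> lphi lpsi phi_inj subW W'W WW'' ker psiphi surj [e' [e'W e'free]] [e'' [e''W e''free]].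
have basis_in (U : lmodType k) d (e : 'I_d -> U) j :
    exists a : 'I_d -> k, e j = \sum_i a i *: e i.
  exists (fun i => (i == j)%:R).
  rewrite (bigD1 j) //= eqxx scale1r big1 ?addr0 // => i /negPf ->.
  by rewrite scale0r.
have /choice[l lE] j : exists v, W v /\ psi v = e'' j.
  by have [|v] := surj (e'' j); [exact/e''W/basis_in|exists v].
exists (fun i : 'I_(d' + d'') => match fintype.split i with inl j => phi (e' j) | inr j => l j end).
have sumE (a : 'I_(d' + d'') -> k) :
    \sum_i a i *: (match fintype.split i with inl j => phi (e' j) | inr j => l j end)
    = phi (\sum_j a (lshift d'' j) *: e' j) + \sum_j a (rshift d' j) *: l j.
  rewrite big_split_ord /= (linear_prop_sum lphi); congr (_ + _); apply: eq_bigr => j _.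
    by rewrite (unsplitK (inl _ j)) (linear_propZ lphi).
  by rewrite (unsplitK (inr _ j)).
have psil (a : 'I_d'' -> k) : psi (\sum_j a j *: l j) = \sum_j a j *: e'' j.
  rewrite (linear_prop_sum lpsi); apply: eq_bigr => j _.
  by rewrite (linear_propZ lpsi) (lE j).2.
have Wsum a : W (\sum_j a j *: l j) by apply: subspace_sum => // j; exact: (lE j).1.
split=> [v|a].
  split=> [Wv|[a ->]]; last first.
    rewrite sumE -[phi _]scale1r; apply: subW.2; last exact: Wsum.
    by apply/W'W/e'W; eexists.
  have /e''W[b bE] := WW'' _ Wv.
  have [||u /e'W[a ->] uE] := ker (v - \sum_j b j *: l j).
  - by rewrite addrC -scaleN1r; exact: subW.2.
  - by rewrite (linear_propB lpsi) bE psil subrr.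
  exists (fun i : 'I_(d' + d'') => match fintype.split i with inl j => a j | inr j => b j end).
  rewrite sumE; under eq_bigr do rewrite (unsplitK (inl _ _)).
  by under [X in _ + X]eq_bigr do rewrite (unsplitK (inr _ _)); rewrite -uE subrK.
rewrite sumE => a0.
have a''0 : forall j, a (rshift d' j) = 0.
  apply: e''free; rewrite -psil -[LHS]add0r -(psiphi (\sum_j a (lshift d'' j) *: e' j)).
  by rewrite -(linear_propD lpsi) a0 (linear_prop0 lpsi).
have a'0 : forall j, a (lshift d'' j) = 0.
  apply: e'free; apply: phi_inj; rewrite (linear_prop0 lphi).
  move: a0; rewrite [X in _ + X]big1 ?addr0 // => j _.
  by rewrite a''0 scale0r.
by move=> i; rewrite -(splitK i); case: (fintype.split i) => j /=.
Qed.

End Dimension.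

(** * Weight spaces on the chart around a fixed point *)

Section WeightSpaces.
Variables (R : realType) (n : nat).
Local Notation C := R[i].
Local Notation torus := (torus R n).
Local Notation OU := (OU R).
Local Notation sheaf := (sheaf R n).
Local Notation chi := (@chi R n).
Implicit Types (I : opn n) (l : weight n).

Lemma cstOD I (c d : C) : cstO I (c + d) = cstO I c + cstO I d.
Proof. exact: OU_eqP. Qed.

Lemma cstO0 I : cstO I (0 : C) = 0.
Proof. exact: OU_eqP. Qed.

(** * Restriction of scalars from O(U_I) to C *)

Section Restrict.
Variables (I : opn n) (M : lmodType (OU I)).

Definition cmod : Type := M.
HB.instance Definition _ := GRing.Zmodule.on cmod.

Definition cscale (c : C) (m : cmod) : cmod := cstO I c *: (m : M).
Lemma cscaleA a b m : cscale a (cscale b m) = cscale (a * b) m.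
Proof. by rewrite /cscale scalerA cstOM. Qed.
Lemma cscale1 : left_id 1 cscale.
Proof. by move=> m; rewrite /cscale cstO1 scale1r. Qed.
Lemma cscaleDr : right_distributive cscale +%R.
Proof. by move=> a u v; exact: scalerDr. Qed.
Lemma cscaleDl m : {morph cscale^~ m : a b / a + b}.
Proof. by move=> a b; rewrite /cscale cstOD scalerDl. Qed.
HB.instance Definition _ :=
  GRing.Zmodule_isLmodule.Build C cmod cscaleA cscale1 cscaleDr cscaleDl.
End Restrict.

Lemma linear_cmod I (M N : lmodType (OU I)) (phi : M -> N) :
  linear phi -> linear (phi : cmod M -> cmod N).
Proof. by move=> lphi a u v; exact: lphi. Qed.

Definition wt (F : sheaf) I l (m : sec F I) : Prop :=
  forall t, act t m = cstO I (chi l t) *: m.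

Lemma act_sum (F : sheaf) I t (T : Type) (r : seq T) (P : pred T) (E : T -> sec F I) :
  act t (\sum_(i <- r | P i) E i) = \sum_(i <- r | P i) act t (E i).
Proof. by apply: big_morph; [exact: actD|exact: act0]. Qed.

Lemma wt_subspace (F : sheaf) I l : subspace (fun m : cmod (sec F I) => wt l m).
Proof.
split=> [t|a u v wu wv t]; first by rewrite act0 scaler0.
rewrite [LHS](actD t (cstO I a *: (u : sec F I))) actZ actO_cst wu wv.
by rewrite [RHS](scalerDr (cstO I (chi l t)) (cstO I a *: (u : sec F I))) !scalerA [_ * cstO I a]mulrC.
Qed.

(** The t_i multiply to 1, so different integer vectors can define the same character; hence
    characters, not vectors, are compared. *)
Lemma wt_chi (F : sheaf) I l l' (m : sec F I) : chi l = chi l' -> wt l m -> wt l' m.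
Proof. by move=> ll' wm t; rewrite -ll'. Qed.

Lemma wt_sum (F : sheaf) I l (T : Type) (r : seq T) (P : pred T) (E : T -> sec F I) :
  (forall i, P i -> wt l (E i)) -> wt l (\sum_(i <- r | P i) E i).
Proof.
by move=> wE t; rewrite act_sum scaler_sumr; apply: eq_bigr => i /wE ->.
Qed.

(* The projector is a product of the operators (t - psi(t)) / (chi(t) - psi(t)),
   with t separating the characters chi and psi. *)
Lemma weight_projector (F : sheaf) I l (cs : seq (weight n)) :
  exists P : sec F I -> sec F I,
    [/\ {morph P : a b / a + b},
        forall m, wt l m -> P m = m
      & forall p m, p \in cs -> chi p <> chi l -> wt p m -> P m = 0].
Proof.
elim: cs => [|q cs [P [PD Pl P0]]]; first by exists id.
have [ql|ql] := pselect (chi q = chi l).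
  exists P; split=> // p m; rewrite inE => /orP[/eqP->|]; [by move=> /(_ ql)|exact: P0].
have [t tP] : exists t, chi l t - chi q t != 0.
  apply: contrapT => nt; apply: ql; apply/funext => t; apply/eqP.
  rewrite eq_sym -subr_eq0; apply/negPn/negP => d0; apply: nt; by exists t.
pose Q (m : sec F I) :=
  cstO I (chi l t - chi q t)^-1 *: (act t m - cstO I (chi q t) *: m).
have QE p m : wt p m ->
    Q m = cstO I ((chi l t - chi q t)^-1 * (chi p t - chi q t)) *: m.
  move=> wm; rewrite /Q wm -scalerBl scalerA cstOM; congr (_ * _ *: _).
  exact: OU_eqP.
exists (P \o Q); split=> [a b|m wm|p m] /=.
- by rewrite -PD /Q actD (scalerDr _ a b) opprD addrACA scalerDr.
- by rewrite (QE _ _ wm) mulVf // cstO1 scale1r Pl.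
- rewrite inE => pcs pl wm.
  have [pq|pq] := pselect (chi p = chi q).
    rewrite (QE _ _ wm) pq subrr mulr0 cstO0 scale0r.
    by apply: (addrI (P 0)); rewrite -PD !addr0.
  case/orP: pcs => [/eqP pq'|pcs]; first by rewrite pq' in pq.
  apply: (P0 p) => //; rewrite (QE _ _ wm) => s.
  by rewrite actZ actO_cst wm !scalerA mulrC.
Qed.

(** The projector to weight l fixes the whole sum and its terms of weight l, and kills all other
    terms. *)
Lemma weight_component (F : sheaf) I l (T : eqType) (s : seq T)
    (w : T -> weight n) (E : T -> sec F I) :
  (forall p, p \in s -> wt (w p) (E p)) -> wt l (\sum_(p <- s) E p) ->
  \sum_(p <- s) E p = \sum_(p <- s | chi (w p) == chi l) E p.
Proof.
move=> wE wl; have [P [PD Pl P0]] := weight_projector F I l (map w s).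
have PZ : P 0 = 0 by apply: (addrI (P 0)); rewrite -PD !addr0.
rewrite -[LHS](Pl _ wl) (big_morph P PD PZ) [RHS]big_mkcond /=.
apply: eq_big_seq => p ps; case: eqP => wp; first by apply/Pl/(wt_chi wp)/wE.
by apply: (P0 (w p)) => //; [exact: map_f|exact: wE].
Qed.

(** * Monomials on the chart around the i-th fixed point *)

Section Chart.
Variable i : 'I_n.+1.

Lemma chart_subproof : [set i] != set0.
Proof. by apply/set0Pn; exists i; exact: set11. Qed.
Definition chart : opn n := exist (fun I : {set 'I_n.+1} => I != set0) _ chart_subproof.
Local Notation pt := (pt R chart).
Local Notation OUi := (OU chart).

Definition expo := {ffun 'I_n.+1 -> nat}.

Definition mono (a : expo) (x : pt) : C := \prod_j (val x j / val x i) ^+ a j.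

Lemma mono_subproof a : is_regular R chart (mono a).
Proof.
apply/asboolP; rewrite /mono; elim: (index_enum _) => [|j r IHr].
  by under eq_fun do rewrite big_nil; exact: regular_cst.
under eq_fun do rewrite big_cons; apply: regular_mul => //.
elim: (a j) => [|k IHk]; first exact: regular_cst.
by under eq_fun do rewrite exprS; apply: regular_mul => //; apply/regular_ratio/set11.
Qed.
Definition monoO (a : expo) : OUi := exist (is_regular R chart) _ (mono_subproof a).

Lemma monoD (a b : expo) x : mono [ffun j => (a j + b j)%N] x = mono a x * mono b x.
Proof. by rewrite -big_split; apply: eq_bigr => j _; rewrite ffunE exprD. Qed.

Lemma mono0 (a : expo) x : (forall j, a j = 0%N) -> mono a x = 1.
Proof. by move=> a0; rewrite [LHS]big1 // => j _; rewrite a0. Qed.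

(** Since x_i / x_i = 1, the exponent at i is arbitrary; fixing it to 0 lets [contr] read off the
    total degree. *)
Lemma mono_span (f : OUi) : exists s : seq (C * expo),
  (forall c, c \in s -> c.2 i = 0%N) /\
  f = \sum_(c <- s) cstO chart c.1 * monoO c.2.
Proof.
suff H : forall g : pt -> C, regular g -> exists s : seq (C * expo),
    (forall c, c \in s -> c.2 i = 0%N) /\
    forall x, g x = \sum_(c <- s) c.1 * mono c.2 x.
  have /asboolP/H[s [s0 sE]] := valP f; exists s; split=> //.
  apply: OU_eqP => x; rewrite sE; elim: {s0 sE} s => [|c s IHs]; first by rewrite !big_nil.
  by rewrite !big_cons IHs.
move=> g; elim=> [c|k j kI|g1 g2 _ [s1 [z1 E1]] _ [s2 [z2 E2]]
                          |g1 g2 _ [s1 [z1 E1]] _ [s2 [z2 E2]]].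
- exists [:: (c, [ffun=> 0%N])]; split=> [b|x]; first by rewrite inE => /eqP->; rewrite ffunE.
  by rewrite big_seq1 mono0 ?mulr1 // => j; rewrite ffunE.
- have -> : k = i by apply/eqP; rewrite -in_set1.
  have [->|ji] := eqVneq j i.
    exists [:: (1, [ffun=> 0%N])]; split=> [b|x]; first by rewrite inE => /eqP->; rewrite ffunE.
    rewrite big_seq1 mono0 ?mulr1 ?divff // => [|j']; last by rewrite ffunE.
    exact/pt_neq0/set11.
  exists [:: (1, [ffun k => (k == j) : nat])]; split=> [b|x].
    by rewrite inE => /eqP->; rewrite ffunE eq_sym (negPf ji).
  rewrite big_seq1 mul1r /mono (bigD1 j) //= ffunE eqxx expr1 big1 ?mulr1 // => k' /negPf kj.
  by rewrite ffunE kj.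
- exists (s1 ++ s2); split=> [c|x]; first by rewrite mem_cat => /orP[/z1|/z2].
  by rewrite big_cat /= -E1 -E2.
- exists [seq (c.1 * d.1, [ffun j => (c.2 j + d.2 j)%N]) | c : C * expo <- s1, d : C * expo <- s2].
  split=> [_ /allpairsP[[c d] /= [cs ds ->]]|x]; first by rewrite ffunE z1 // z2.
  rewrite big_allpairs_dep /= E1 E2 mulr_suml; apply: eq_bigr => c _.
  by rewrite mulr_sumr; apply: eq_bigr => d _; rewrite monoD mulrACA.
Qed.

(** With the action through t^-1, the function x_j / x_i has weight eps_i - eps_j. *)
Definition monow (a : expo) : weight n := \sum_j Defs.root i j *+ a j.

Lemma chi_root (j : 'I_n.+1) t : chi (Defs.root i j) t = val t i / val t j.
Proof.
apply: (mulIf (torus_neq0 t j)); rewrite divfK ?torus_neq0 // root_eps.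
by rewrite -{1}(chi_eps j t) -chiD subrK chi_eps.
Qed.

Lemma chi_monow a t : chi (monow a) t = \prod_j (val t i / val t j) ^+ a j.
Proof.
rewrite /monow (big_morph (chi^~ t) (fun l m => chiD l m t) (chi0 t)).
apply: eq_bigr => j _; rewrite -chi_root; elim: (a j) => [|k IHk].
  by rewrite mulr0n chi0.
by rewrite mulrS chiD IHk exprS.
Qed.

Lemma actO_mono a t : actO t (monoO a) = cstO chart (chi (monow a) t) * monoO a.
Proof.
apply: OU_eqP => x; rewrite [RHS](_ : _ = chi (monow a) t * mono a x) //.
rewrite chi_monow -big_split; apply: eq_bigr => j _ /=.
rewrite -exprMn !ffunE invfM invrK; congr (_ ^+ _).
move: (val t j)^-1 (val t i) (val x j) (val x i)^-1 => a1 a2 a3 a4.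
by ring.
Qed.

(* [contr] acts on every coordinate function x_j / x_i, j <> i, by the same
   scalar 2^(n+1) > 1. *)
Definition contr_fun : {ffun 'I_n.+1 -> C} :=
  [ffun k => if k == i then 2 ^+ n else 2^-1].
Lemma contr_subproof : in_torus contr_fun.
Proof.
rewrite /in_torus (bigD1 i) //= ffunE eqxx.
under eq_bigr => j /negPf ji do rewrite ffunE ji.
rewrite prodr_const cardC1 card_ord /= exprVn divff // expf_neq0 //.
by rewrite pnatr_eq0.
Qed.
Definition contr : torus := exist (@in_torus R n) _ contr_subproof.

Lemma chi_contr_monow (a : expo) : a i = 0%N ->
  chi (monow a) contr = (2 ^+ n.+1) ^+ (\sum_j a j).
Proof.
move=> ai; rewrite chi_monow -prodrXr; apply: eq_bigr => j _.
have [->|ji] := eqVneq j i; first by rewrite ai.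
by rewrite /= !ffunE eqxx (negPf ji) invrK exprSr.
Qed.

Lemma chi_contr_gt0 l : 0 < chi l contr.
Proof.
apply: prodr_gt0 => j _; rewrite exprz_gt0 // ffunE.
by case: eqP => _; rewrite ?exprn_gt0 ?invr_gt0 ?ltr0n.
Qed.

Lemma gt1_pow : (1 : C) < 2 ^+ n.+1.
Proof. by rewrite exprn_egt1 // ltr1n. Qed.

(** * Finiteness of the weight spaces of a module generated by weight vectors *)

Section Generated.
Variables (F : sheaf) (s : seq (weight n * sec F chart)).
Hypothesis s_wt : forall p, p \in s -> wt p.1 p.2.
Hypothesis s_gen : forall m, exists v : seq (OUi * (weight n * sec F chart)),
  (forall q, q \in v -> q.2 \in s) /\ m = \sum_(q <- v) q.1 *: q.2.2.

(** The coefficients are expanded in monomials, which makes every term a weight vector;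
    [weight_component] then discards the terms of other weights. *)
Lemma weight_span l (m : sec F chart) : wt l m ->
  exists u : seq (C * expo * (weight n * sec F chart)),
  [/\ forall q, q \in u ->
        [/\ q.2 \in s, q.1.2 i = 0%N & chi (monow q.1.2 + q.2.1) = chi l]
    & m = \sum_(q <- u) (cstO chart q.1.1 * monoO q.1.2) *: q.2.2].
Proof.
move=> wm; have [v [vs mE]] := s_gen m.
pose good (u : seq (C * expo * (weight n * sec F chart))) :=
  forall q, q \in u -> q.2 \in s /\ q.1.2 i = 0%N.
pose val_u (u : seq (C * expo * (weight n * sec F chart))) :=
  \sum_(q <- u) (cstO chart q.1.1 * monoO q.1.2) *: q.2.2.
have [u [ug uE]] : exists u, good u /\ m = val_u u.
  rewrite mE big_seq.
  apply: (big_ind (fun m => exists u, good u /\ m = val_u u)) => [|x y [u [ug ->]] [w [wg ->]]|k kv].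
  - by exists [::]; rewrite /val_u big_nil.
  - exists (u ++ w); rewrite /val_u big_cat; split=> // q.
    by rewrite mem_cat => /orP[/ug|/wg].
  have [c [c0 ->]] := mono_span k.1.
  exists [seq (d, k.2) | d <- c]; split.
    by move=> _ /mapP[d dc ->]; split; [exact: vs|exact: c0].
  by rewrite /val_u big_map scaler_suml.
exists [seq q <- u | chi (monow q.1.2 + q.2.1) == chi l]; split.
  by move=> q; rewrite mem_filter => /andP[/eqP -> /ug[]].
rewrite big_filter uE; apply: weight_component; last by rewrite -/(val_u u) -uE.
move=> q /ug[qs _] t; rewrite actZ (s_wt qs) !scalerA; congr (_ *: _).
have -> : actO t (cstO chart q.1.1 * monoO q.1.2)
        = actO t (cstO chart q.1.1) * actO t (monoO q.1.2) by exact: OU_eqP.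
by rewrite actO_cst actO_mono chiD cstOM; ring.
Qed.

(** At [contr] a monomial of degree d contributes the d-th power of 2^(n+1) > 1. So each generator
    admits at most one degree in weight l, and finitely many monomials suffice. *)
Lemma weight_space_span l : exists gs : seq (cmod (sec F chart)),
  forall m : cmod (sec F chart), wt l m -> in_span gs m.
Proof.
have [N NP] : exists N : nat, forall p, p \in s -> forall d,
    (2 ^+ n.+1) ^+ d * chi p.1 contr = chi l contr -> (d <= N)%N.
  elim: (s) => [|p s' [N NP]]; first by exists 0%N.
  have [[d0 d0E]|nd] := pselect (exists d,
      (2 ^+ n.+1) ^+ d * chi p.1 contr = chi l contr).
    exists (maxn d0 N) => q; rewrite inE => /orP[/eqP->|qs'] d dE.
      rewrite leq_max; apply/orP; left.
      have /mulIf := etrans dE (esym d0E).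
      rewrite gt_eqF ?chi_contr_gt0 // => /(_ isT) dd.
      by rewrite (ieexprIn (lt_trans ltr01 gt1_pow) _ dd) // gt_eqF ?gt1_pow.
    by rewrite leq_max (NP q) ?orbT.
  exists N => q; rewrite inE => /orP[/eqP->|qs'] d dE; last exact: (NP q).
  by case: nd; exists d.
pose gs := [seq monoO [ffun j => nat_of_ord (b j)] *: p.2
             | b : {ffun 'I_n.+1 -> 'I_N.+1} <- enum {ffun 'I_n.+1 -> 'I_N.+1}, p <- s].
exists gs => m wm; have [u [us ->]] := weight_span wm.
rewrite big_seq; apply: (big_ind (in_span (gs : seq (cmod _)))) => [|x y sx sy|q qu].
- exact: in_span0.
- by rewrite -[x]scale1r; exact: in_span_lin.
have [qs q0 qE] := us _ qu; rewrite -scalerA.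
suff H : (monoO q.1.2 *: q.2.2) \in gs.
  have := in_span_lin q.1.1 (in_span_mem (H : _ \in (gs : seq (cmod _)))) (in_span0 _).
  by rewrite addr0.
have qN j : (q.1.2 j < N.+1)%N.
  rewrite ltnS; apply: leq_trans (NP _ qs (\sum_k q.1.2 k)%N _).
    by rewrite (bigD1 j) //= leq_addr.
  by rewrite -chi_contr_monow // -chiD qE.
apply/allpairsP; exists ([ffun j => Ordinal (qN j)], q.2); split=> //.
  by rewrite mem_enum.
by congr (monoO _ *: _); apply/ffunP => j; rewrite !ffunE.
Qed.

End Generated.

(** By algebraicity of the action, every generator splits into finitely many weight vectors. *)
Lemma weight_generators (F : sheaf) : exists s : seq (weight n * sec F chart),
  (forall p, p \in s -> wt p.1 p.2) /\
  forall m, exists v : seq (OUi * (weight n * sec F chart)),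
    (forall q, q \in v -> q.2 \in s) /\ m = \sum_(q <- v) q.1 *: q.2.2.
Proof.
have [r [e eE]] := @sec_fg _ _ F chart.
have /choice[s sE] k := act_alg (e k).
exists [seq p | k <- enum 'I_r, p <- s k]; split.
  by move=> _ /allpairsPdep[k [p [_ ps ->]]]; exact: (sE k).1.
move=> m; have [a ->] := eE m.
exists [seq (a k, p) | k <- enum 'I_r, p <- s k]; split.
  move=> _ /allpairsPdep[k [p [kr ps ->]]].
  by apply/allpairsPdep; exists k, p.
rewrite big_allpairs_dep /= big_enum /=; apply: eq_bigr => k _.
by rewrite {1}(sE k).2 scaler_sumr.
Qed.

Lemma wt_has_dim (F : sheaf) l :
  exists d, has_dim (fun m : cmod (sec F chart) => wt l m) d.
Proof.
have [s [s_wt s_gen]] := weight_generators F.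
have [gs gsP] := weight_space_span s_wt s_gen l.
exact: has_dim_in_span (wt_subspace _ _ _) gsP.
Qed.

Definition wdim l (F : sheaf) : nat := projT1 (cid (wt_has_dim F l)).

Lemma wdimP l F : has_dim (fun m : cmod (sec F chart) => wt l m) (wdim l F).
Proof. by rewrite /wdim; case: cid. Qed.

Lemma wdim_eq l F d :
  has_dim (fun m : cmod (sec F chart) => wt l m) d -> wdim l F = d.
Proof. exact: has_dim_uniq (wdimP l F). Qed.

Lemma wdim_exact l (F' F F'' : sheaf) : short_exact F' F F'' ->
  wdim l F = (wdim l F' + wdim l F'')%N.
Proof.
move=> [phi [psi [[lphi _ aphi] [[lpsi _ apsi] ex]]]]; apply: wdim_eq.
have [inj ker surj] := ex chart.
have wt_phi m : wt l m -> wt l (phi chart m).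
  by move=> wm t; rewrite -aphi wm (linear_propZ (lphi chart)).
have wt_psi p m : wt p m -> wt p (psi chart m).
  by move=> wm t; rewrite -apsi wm (linear_propZ (lpsi chart)).
apply: (has_dim_exact (linear_cmod (lphi chart)) (linear_cmod (lpsi chart)) inj
  (wt_subspace _ _ _) wt_phi (wt_psi l) _ _ _ (wdimP l F') (wdimP l F'')).
- move=> m wm /ker[u mE]; exists u => // t; apply: inj.
  by rewrite aphi -mE wm mE (linear_propZ (lphi chart)).
- by move=> m; apply/ker; exists m.
(* An arbitrary lift need not be a weight vector, but its component of weight l still maps to m. *)
move=> m wm; have [m1 m1E] := surj m; have [s [ws m1s]] := act_alg m1.
exists (\sum_(p <- s | chi p.1 == chi l) p.2).
  rewrite big_seq_cond; apply: wt_sum => p /andP[/ws wp /eqP pl].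
  exact: wt_chi pl _.
rewrite [LHS](linear_prop_sum (lpsi chart)).
rewrite -weight_component -?(linear_prop_sum (lpsi chart)) -?m1s ?m1E //.
by move=> p /ws; exact: wt_psi.
Qed.

Lemma wdim_chi_eq l p q F : chi p = chi q -> wdim l (twist p F) = wdim l (twist q F).
Proof.
move=> pq; apply: wdim_eq; have [e [eW efree]] := wdimP l (twist q F).
exists e; split=> // v; rewrite -eW /wt /= /twist_act.
by split=> wv t; move: (wv t); rewrite pq.
Qed.

Lemma wdim_OX_lt l p (w : 'I_n.+1) : (w < i)%N -> wdim l (twist p (OX R w)) = 0%N.
Proof.
move=> wi; apply: wdim_eq; exists (fun=> 0).
have all0 (v : OXsec R w chart) : v = 0.
  apply: OXsec_eqP => x; have /forallP/(_ i)/implyP/(_ wi) := valP x.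
  by move=> /eqP xi; have := pt_neq0 (val x) (set11 i); rewrite xi eqxx.
split=> [v|a _ []//]; split=> [_|_]; last by rewrite (all0 v) => t; rewrite act0 scaler0.
by exists (fun=> 0); rewrite big_ord0; exact: all0.
Qed.

Section StructureSheaf.
Variable p : weight n.
Let F := twist p (OX R i).

Lemma one_i_subproof : @is_xregular R n i chart (fun=> 1).
Proof. by apply/asboolP; exists 1. Qed.
Definition one_i : OXsec R i chart := exist (@is_xregular R n i chart) _ one_i_subproof.

Lemma one_i_neq0 : one_i <> 0.
Proof.
move=> /(congr1 val) E.
(* The function 1 is tested at the i-th fixed point, which lies in X_i and in the chart. *)
have xU : in_U chart ([ffun k => (k == i)%:R] : {ffun 'I_n.+1 -> C}).
  apply/forall_inP => j; rewrite in_set1 => /eqP ->.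
  by rewrite ffunE eqxx oner_neq0.
have xX : in_X i (exist (in_U chart) _ xU).
  apply/forallP => j; apply/implyP => ij; rewrite ffunE.
  by case: (j =P i) ij => // ->; rewrite ltnn.
have := congr1 (@^~ (exist (@in_X R n i chart) _ xX)) E.
by move=> /eqP; rewrite [_ == _](_ : _ = (1 == 0 :> C)) // oner_eq0.
Qed.

Lemma one_i_wt : wt p (one_i : sec F chart).
Proof.
move=> t; rewrite /= /twist_act /=; congr (_ *: _).
exact: OXsec_eqP.
Qed.

Lemma one_i_gen (m : sec F chart) : exists v : seq (OUi * (weight n * sec F chart)),
  (forall q, q \in v -> q.2 \in [:: (p, one_i : sec F chart)]) /\
  m = \sum_(q <- v) q.1 *: q.2.2.
Proof.
have /asboolP[f mf] := valP (m : OXsec R i chart).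
exists [:: (f, (p, one_i : sec F chart))]; split.
  by move=> q; rewrite inE => /eqP ->; exact: mem_head.
rewrite big_seq1; apply: (@OXsec_eqP R n i chart) => x; rewrite mf.
by rewrite [RHS](_ : _ = val f (val x) * 1) // mulr1.
Qed.

Lemma one_i_wts q : q \in [:: (p, one_i : sec F chart)] -> wt q.1 q.2.
Proof. by rewrite inE => /eqP ->; exact: one_i_wt. Qed.

(* Nonconstant monomials have weight > 1 on the contracting element, so only
   constants contribute to the weights l below p. *)
Lemma wt_OX l (m : sec F chart) : chi l contr <= chi p contr -> wt l m -> m != 0 ->
  chi p = chi l /\ exists c, m = cstO chart c *: (one_i : sec F chart).
Proof.
move=> lp wm m0; have [u [us mE]] := weight_span one_i_wts one_i_gen wm.
have uP q : q \in u -> [/\ q.2.2 = one_i, q.2.1 = p & forall j, q.1.2 j = 0%N].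
  move=> /us[]; rewrite inE => /eqP q2 q0 qE; rewrite q2; split=> //.
  have : (2 ^+ n.+1) ^+ (\sum_j q.1.2 j) * chi p contr <= 1 * chi p contr.
    by rewrite mul1r -chi_contr_monow // -chiD; move: qE; rewrite q2 /= => ->.
  rewrite ler_pM2r ?chi_contr_gt0 //.
  case sum_q : (\sum_j q.1.2 j)%N => [|k].
    by move=> _ j; have /eqP := sum_q; rewrite sum_nat_eq0 => /forallP/(_ j)/eqP.
  by rewrite lt_geF // exprn_egt1 ?gt1_pow.
split.
  case: u us uP mE => [|q u] us uP mE; first by rewrite mE big_nil eqxx in m0.
  have [_ _ <-] := us q (mem_head _ _); have [_ -> q0] := uP q (mem_head _ _).
  apply/funext => t; rewrite chiD chi_monow big1 ?mul1r // => j _.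
  by rewrite q0.
exists (\sum_(q <- u) q.1.1).
rewrite mE (big_morph _ (cstOD chart) (cstO0 chart)) scaler_suml.
apply: eq_big_seq => q /uP[-> _ q0]; congr (_ *: _).
by apply: OU_eqP => x; rewrite [LHS](_ : _ = q.1.1 * mono q.1.2 x) // mono0 ?mulr1.
Qed.

Lemma wdim_OX l : chi l contr <= chi p contr -> wdim l F = (chi p == chi l).
Proof.
move=> lp; apply: wdim_eq; case: eqP => [pl|pl].
  exists (fun=> (one_i : sec F chart)); split=> [v|a].
    split=> [wv|[a ->]]; last first.
      rewrite big_ord1; apply: (wt_chi pl) => t.
      by rewrite actZ actO_cst one_i_wt !scalerA mulrC.
    have [->|v0] := eqVneq v 0; first by exists (fun=> 0); rewrite big_ord1 scale0r.
    have [_ [c ->]] := wt_OX lp wv v0.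
    by exists (fun=> c); rewrite big_ord1.
  rewrite big_ord1 => a0 j; rewrite ord1; apply/eqP/negPn/negP => an0; apply: one_i_neq0.
  have := congr1 (fun v : cmod (sec F chart) => (a 0)^-1 *: v) a0.
  by rewrite scalerA mulVf // scale1r scaler0.
exists (fun=> 0); split=> [v|a _ []//]; split=> [wv|[a ->]]; last first.
  by rewrite big_ord0 => t; rewrite act0 scaler0.
exists (fun=> 0); rewrite big_ord0; apply/eqP/negPn/negP => v0.
by have [/pl] := wt_OX lp wv v0.
Qed.

End StructureSheaf.

End Chart.

End WeightSpaces.

(** * Linear independence of the classes *)

Section Independence.
Variables (R : realType) (n : nat).
Local Notation C := R[i].
Local Notation RT := (RT R n).
Local Notation chi := (@chi R n).
Variables (K : comAlgType RT) (cls : sheaf R n -> K) (hK : is_KT cls).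

Lemma RT_sum (c : RT) : exists s : seq (int * weight n),
  c = \sum_(p <- s) (expc R p.2) *~ p.1.
Proof.
have /asboolP[s cE] := valP c; exists s; apply/val_inj/funext => t; rewrite cE.
elim: {cE} s => [|p s IHs]; first by rewrite !big_nil.
rewrite !big_cons [RHS](_ : _ = val ((expc R p.2) *~ p.1) t
  + val (\sum_(p <- s) (expc R p.2) *~ p.1) t) // -IHs; congr (_ + _).
have nE k : val (expc R p.2 *+ k) t = chi p.2 t *+ k.
  by elim: k => // k IHk; rewrite !mulrS -IHk.
case: p.1 => k; first by rewrite -pmulrn mulr_natl -nE.
by rewrite !NegzE !mulrNz mulNr -!pmulrn mulr_natl -nE.
Qed.

(** C is only partially ordered, but positive values are real and hence comparable. *)
Lemma exists_min (T : eqType) (f : T -> C) (s : seq T) :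
  (forall p, 0 < f p) -> s != [::] ->
  exists2 p, p \in s & forall q, q \in s -> f p <= f q.
Proof.
move=> f0; elim: s => // p s IHs _; have [->|s0] := eqVneq s [::].
  by exists p => [|q]; rewrite inE // => /eqP ->.
have [q qs qmin] := IHs s0.
have /orP[pq|qp] := real_leVge (gtr0_real (f0 p)) (gtr0_real (f0 q)).
  exists p => [|r]; rewrite inE ?eqxx // => /orP[/eqP->//|/qmin].
  exact: le_trans.
by exists q => [|r]; rewrite inE ?qs ?orbT // => /orP[/eqP->|/qmin].
Qed.

(** Tested at the weight of a [lam]-minimal term p0, [h] sees exactly the terms with the character
    of p0. Their coefficients thus add up to 0, these terms drop out, and a shorter list remains. *)
Lemma triangular_chars (lam : weight n -> C) (h : weight n -> weight n -> int)
    (s : seq (int * weight n)) :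
  (forall l, 0 < lam l) ->
  (forall l p q, chi p = chi q -> h l p = h l q) ->
  (forall l p, lam l <= lam p -> h l p = (chi p == chi l)%:R) ->
  (forall l, \sum_(p <- s) p.1 * h l p.2 = 0) ->
  \sum_(p <- s) (expc R p.2) *~ p.1 = 0.
Proof.
move=> lam0 h_chi h_lam; move: {2}(size s) (leqnn (size s)) => N.
elim: N s => [|N IHN] s; first by rewrite leqn0 size_eq0 => /eqP-> _; rewrite big_nil.
move=> sN s0; have [->|sn0] := eqVneq s [::]; first by rewrite big_nil.
have [p0 ps p0min] := exists_min (fun p : int * weight n => lam0 p.2) sn0.
pose P (p : int * weight n) := chi p.2 == chi p0.2.
have P0 : \sum_(p <- s | P p) p.1 = 0.
  rewrite -[RHS](s0 p0.2) big_mkcond; apply: eq_big_seq => p /p0min pp0.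
  by rewrite h_lam //= /P; case: eqP; rewrite ?mulr1 ?mulr0.
have drop (V : zmodType) (E : int * weight n -> V) :
    \sum_(p <- s | P p) E p = 0 -> \sum_(p <- s) E p = \sum_(p <- filter (predC P) s) E p.
  by move=> E0; rewrite (bigID P) /= E0 add0r big_filter.
rewrite drop; last first.
  under eq_bigr => p /eqP pp0.
    rewrite (_ : expc R p.2 = expc R p0.2); last exact: val_inj.
    over.
  by rewrite -mulrz_sumr P0 mulr0z.
apply: IHN => [|l]; last first.
  rewrite -drop ?s0 //.
  under eq_bigr => p /eqP pp0 do rewrite (h_chi _ _ _ pp0).
  by rewrite -mulr_suml P0 mul0r.
rewrite -ltnS; apply: leq_trans sN; rewrite size_filter -(count_predC P s).
by rewrite -[X in (X < _)%N]add0n ltn_add2r -has_count; apply/hasP; exists p0; rewrite // /P eqxx.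
Qed.

(** Descending induction on i: on the chart around the i-th fixed point the classes with w < i are
    invisible, and the coefficients with w > i are already zero. *)
Lemma cls_independent (c : 'I_n.+1 -> RT) :
  \sum_w c w *: cls (OX R w) = 0 -> forall w, c w = 0.
Proof.
move=> c0.
suff H N : forall w : 'I_n.+1, (n - w < N)%N -> c w = 0 
  by move=> w; apply: (H n.+1); rewrite ltnS leq_subr.
elim: N => // N IHN i; rewrite ltnS leq_eqVlt => /orP[/eqP iN|]; last exact: IHN.
have cgt (w : 'I_n.+1) : (i < w)%N -> c w = 0.
  by move=> iw; apply: IHN; have := ltn_ord w; lia.
have [s cE] := RT_sum (c i).
rewrite cE; apply: (triangular_chars (lam := fun l => chi l (contr R i))
  (h := fun l p => (wdim i l (twist p (OX R i)))%:Z)) => [l|l p q pq|l p lp|l].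
- exact: chi_contr_gt0.
- by rewrite (wdim_chi_eq i l _ pq).
- by rewrite wdim_OX //; case: (_ == _).
have [f fE] : exists f : {additive K -> int}, forall F, f (cls F) = (wdim i l F)%:Z.
  apply: (KT_universal hK (phi := fun F => (wdim i l F)%:Z)) => F1 F2 F3 /wdim_exact ->.
  by rewrite PoszD.
(* The functional f is only additive, so scalars are expanded into characters, which act as
   twists. *)
have fZ (d : RT) (r : seq (int * weight n)) F : d = \sum_(p <- r) (expc R p.2) *~ p.1 ->
    f (d *: cls F) = \sum_(p <- r) p.1 * (wdim i l (twist p.2 F))%:Z.
  move=> ->; rewrite scaler_suml raddf_sum; apply: eq_bigr => p _.
  by rewrite -scalerMzl raddfMz /= (KT_scale hK) fE -mulrzl intz.
have := congr1 f c0; rewrite raddf0 raddf_sum (bigD1 i) //= big1 ?addr0.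
  by rewrite (fZ _ _ _ cE).
move=> w wi; have [iw|] := ltnP i w; first by rewrite cgt // scale0r raddf0.
rewrite leq_eqVlt val_eqE (negPf wi) /= => wi'.
have [r rE] := RT_sum (c w).
by rewrite (fZ _ _ _ rE) big1 // => p _; rewrite wdim_OX_lt ?mulr0.
Qed.

End Independence.

(* b u v w is the structure constant b^w_{u,v} *)
Theorem theorem6p18 (R : realType) (n : nat)
    (K : comAlgType (RT R n)) (cls : sheaf R n -> K) (hK : is_KT cls)
    (b : 'I_n.+1 -> 'I_n.+1 -> 'I_n.+1 -> RT R n)
    (hb : forall u v : 'I_n.+1,
       cls (OX R u) * cls (OX R v) = \sum_(w < n.+1) b u v w *: cls (OX R w)) :
  let r (u v w : 'I_n.+1) : RT R n :=
    wo (b (rev_ord u) (rev_ord v) (rev_ord w)) in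
  (forall u v w : 'I_n.+1, Zplus_neg ((-1) ^+ (u + v + w) * r u v w)) /\
  (forall u v w : 'I_n.+1, Zplus_pos ((-1) ^+ (n + u + v + w) * b u v w)).
Proof.
move=> r.
(* O_u arises from the class of the whole space by n - u operators, so [A_mul] applies with d = n -
   u; independence identifies the coefficients. *)
have bE u v w : b u v w = strc R n (n - u) v w.
  apply/eqP; rewrite -subr_eq0; apply/eqP; move: w.
  apply: (cls_independent hK (c := fun w => b u v w - strc R n (n - u) v w)).
  under eq_bigr do rewrite scalerBl.
  rewrite sumrB -hb; apply/eqP; rewrite subr_eq0; apply/eqP.
  have AE (m : 'I_n.+1) : cls (OX R m) = coordcls cls m.+1 0 by rewrite /= inord_val.
  under eq_bigr do rewrite AE.
  have un : (u <= n)%N by rewrite -ltnS ltn_ord.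
  rewrite !AE (_ : u.+1 = n.+1 - (n - u))%N; last by lia.
  rewrite (A_mul (coordcls0 cls) (coordclsS hK) (coordclsM hK)) ?big_mkord //; first lia.
  by rewrite -ltnS ltn_ord.
have sgn (j k : nat) : odd j = odd k -> (-1) ^+ j = (-1) ^+ k :> RT R n.
  by move=> jk; rewrite -signr_odd jk signr_odd.
have pos (u v w : 'I_n.+1) : Zplus_pos ((-1) ^+ (n + u + v + w) * b u v w).
  have := ltn_ord u; have := ltn_ord v; rewrite !ltnS => vn un.
  rewrite bE (sgn _ (n - u + v + w)%N); first by apply: strc_pos; lia.
  by rewrite !oddD oddB.
split=> // u v w; have := wo_Zplus (pos (rev_ord u) (rev_ord v) (rev_ord w)).
(* The reversed exponent n + (n - u) + (n - v) + (n - w) has the parity of u + v + w. *)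
rewrite rmorphM rmorphXn rmorphN1 /= -/(r u v w) (sgn _ (u + v + w)%N) //.
have le_n (x : 'I_n.+1) : (x <= n)%N by rewrite -ltnS.
rewrite !oddD /= !subSS !oddB ?le_n //.
by case: (odd n) (odd u) (odd v) (odd w) => [] [] [] [].
Qed.
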